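(* Let $(Y_m)_{m\ge 1}$ be independent continuous random variables on $[0,1)$, not necessarily identically distributed, with densities $(g_m)_{m\ge 1}$, $g_m\in L^1([0,1])$. Then the sum $Y_1+\cdots+Y_M$ modulo $1$ converges to the uniform distribution as $M\to\infty$ in $L^1([0,1])$, i.e. the density $h_M$ of $Y_1+\cdots+Y_M \bmod 1$ satisfies $\lim_{M\to\infty}\int_0^1 |h_M(x)-1|\,dx=0$, if and only if for each integer $n\neq 0$ we have $$\lim_{M\to\infty}\widehat{g_1}(n)\,\widehat{g_2}(n)\cdots\widehat{g_M}(n)=0.$$
   Context: A continuous random variable on $[0,1)$ means one whose distribution has a density in $L^1([0,1])$ with respect to Lebesgue measure. For a probability density $g$ on $[0,1]$ and $n\in\mathbb{Z}$, the $n$-th Fourier coefficient is $\widehat{g}(n)=\int_0^1 g(x)e^{-2\pi i n x}\,dx$. *)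

(* Defs.v *)
From HB Require Import structures.
From mathcomp Require Import all_boot all_order all_algebra.
From mathcomp Require Import all_classical all_reals all_analysis.
From mathcomp Require Import complex.
Set Implicit Arguments.
Unset Strict Implicit.
Unset Printing Implicit Defensive.
Import Order.TTheory GRing.Theory Num.Theory.
Import numFieldNormedType.Exports.
Local Open Scope classical_set_scope.
Local Open Scope ring_scope.
Local Open Scope complex_scope.

Definition mutually_independent (d : measure_display) (T : measurableType d)
    (R : realType) (P : probability T R) (Y : nat -> {RV P >-> R}) : Prop :=
  forall (s : seq nat) (A : nat -> set R), uniq s ->
    (forall i, measurable (A i)) ->
    P (\bigcap_(i in [set` s]) (Y i @^-1` A i)) =
    (\prod_(i <- s) P (Y i @^-1` A i))%E.

(* X is a continuous random variable on [0, 1[ with density g; only the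
   restriction of g to [0, 1] matters. *)
Definition has_density01 (d : measure_display) (T : measurableType d)
    (R : realType) (P : probability T R) (X : T -> R) (g : R -> R) : Prop :=
  [/\ forall t, 0 <= X t < 1,
      (@lebesgue_measure R).-integrable `[0, 1] (EFin \o g),
      forall x, 0 <= x <= 1 -> 0 <= g x
    & forall A : set R, measurable A ->
      P (X @^-1` A) =
      (\int[@lebesgue_measure R]_(x in A `&` `[0%R, 1%R]) (g x)%:E)%E].

Definition mod1 (R : realType) (x : R) : R := x - (Num.floor x)%:~R.

Definition expi (R : realType) (t : R) : R[i] := cos t +i* sin t.

Definition integral01C (R : realType) (f : R -> R[i]) : R[i] :=
  Rintegral (@lebesgue_measure R) `[0, 1] (fun x => complex.Re (f x)) +i*
  Rintegral (@lebesgue_measure R) `[0, 1] (fun x => complex.Im (f x)).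

Definition fourier_coef (R : realType) (g : R -> R) (n : int) : R[i] :=
  integral01C (fun x => (g x)%:C * expi (- (2 * pi * n%:~R * x))).

(* Main.v *)
(* Write S for the sum of the variables, X for the first one (density g) and Z
   for the sum of the others, which is independent of X; let K be the Fejer
   kernel of order k.  Conditioning on Z, replacing g by its Fejer mean changes
   the expectation of phi(S mod 1), for |phi| <= 1, by at most ||g - K * g||_1,
   uniformly in the number of variables.  After the replacement the expectation
   is a finite combination of the Fourier coefficients of S, with constant term
   the mean of phi.  Taking phi to be the sign of h - 1 bounds ||h - 1||_1.
   Smoothing g itself, rather than approximating it by an arbitrary
   trigonometric polynomial, is what makes the Fourier coefficients of S appear
   also at the frequencies where the coefficient of g vanishes.  Finally
   ||g - K * g||_1 tends to 0: for continuous g a Korovkin argument gives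
   pointwise convergence on ]0, 1[, because K(t) (1 - cos (2 pi t)) has mean
   1/k. *)
Require Import Defs.
From HB Require Import structures.
From mathcomp Require Import all_boot all_order all_algebra.
From mathcomp Require Import all_classical all_reals all_analysis.
From mathcomp Require Import complex measurable_realfun ring lra zify.
Set Implicit Arguments.
Unset Strict Implicit.
Unset Printing Implicit Defensive.
Import Order.TTheory GRing.Theory Num.Theory.
Import numFieldNormedType.Exports.
Local Open Scope classical_set_scope.
Local Open Scope ring_scope.
Local Open Scope complex_scope.

(** * Bounded measurable functions and their integrals *)

Section bounded_measurable.
Context d (T : measurableType d) (R : realType).

(** The order [k] of the kernel is chosen from the first density alone, before M grows; this is what
    the uniformity in the number of variables is for. In the converse direction, [tcos n] and
    [tsin n] have mean 0 for n != 0, so a Fourier coefficient of the sum is an integral against h -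
    1. No density of a sum is written as a convolution. Independence is given for events only, so
    Fourier coefficients are turned into expectations under [P], the independence of the first
    variable and the sum of the others is extracted by induction, and Fubini for the joint law does
    the work of the convolution theorem. The Fejer kernel is preferred for its positivity, which
    yields both the L1 contraction and the Korovkin estimate. The latter stays inside ]0, 1[ because
    0 and 1 are the same point modulo 1, whereas a continuous f may take two different values there.
    Test functions live in the class [bounded_measurable], stable under sums, products and
    composition with measurable maps, and integrable for every finite measure. *)

Definition bounded_measurable (f : T -> R) :=
  measurable_fun setT f /\ exists B, forall x, `|f x| <= B.

Lemma bounded_measurable_integrable (m : {measure set T -> \bar R}) (D : set T)
    (f : T -> R) : measurable D -> (m D < +oo)%E -> bounded_measurable f ->
  m.-integrable D (EFin \o f).
Proof.
move=> mD mDoo [mf [B fB]]; apply: measurable_bounded_integrable => //.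
  exact: measurable_funTS.
exists B; split; first exact: num_real.
by move=> M BM x _ /=; rewrite (le_trans (fB x)) ?ltW.
Qed.

Lemma bounded_measurable_indic (A : set T) :
  measurable A -> bounded_measurable (\1_A).
Proof.
move=> mA; split; first exact: measurable_indic.
by exists 1 => x; rewrite indicE; case: (_ \in _); rewrite ?normr1 ?normr0.
Qed.

Lemma bounded_measurable_cst (c : R) : bounded_measurable (fun=> c).
Proof. by split; [exact: measurable_cst|exists `|c|]. Qed.

Lemma bounded_measurableM (f g : T -> R) : bounded_measurable f ->
  bounded_measurable g -> bounded_measurable (fun x => f x * g x).
Proof.
move=> [mf [B fB]] [mg [C gC]]; split; first exact: measurable_funM.
by exists (B * C) => x; rewrite normrM ler_pM.
Qed.

Lemma bounded_measurableD (f g : T -> R) : bounded_measurable f ->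
  bounded_measurable g -> bounded_measurable (fun x => f x + g x).
Proof.
move=> [mf [B fB]] [mg [C gC]]; split; first exact: measurable_funD.
by exists (B + C) => x; rewrite (le_trans (ler_normD _ _)) ?lerD.
Qed.

Lemma bounded_measurable_sum (I : Type) (s : seq I) (f : I -> T -> R) :
  (forall i, bounded_measurable (f i)) ->
  bounded_measurable (fun x => \sum_(i <- s) f i x).
Proof.
move=> bf; elim: s => [|i s IH].
  under eq_fun do rewrite big_nil; exact: bounded_measurable_cst.
by under eq_fun do rewrite big_cons; exact: bounded_measurableD.
Qed.

Lemma bounded_measurable_mul_integrable (m : {measure set T -> \bar R})
    (D : set T) (f g : T -> R) : measurable D -> m.-integrable D (EFin \o f) ->
  bounded_measurable g -> m.-integrable D (EFin \o (fun x => g x * f x)).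
Proof.
move=> mD intf [mg [B gB]].
have : m.-integrable D (fun x => (B%:E * (f x)%:E)%E) by exact: integrableZl.
apply: le_integrable => //.
  apply/measurable_EFinP/measurable_funM; first exact: measurable_funTS.
  exact/measurable_EFinP/(measurable_int _ intf).
move=> x _; rewrite -EFinM /= lee_fin !normrM ler_wpM2r//.
by rewrite (le_trans (gB x))// ler_norm.
Qed.

Lemma Rintegral_sum (m : {measure set T -> \bar R}) (D : set T) (I : Type)
    (s : seq I) (f : I -> T -> R) : measurable D ->
  (forall i, m.-integrable D (EFin \o f i)) ->
  \int[m]_(x in D) (\sum_(i <- s) f i x) =
  \sum_(i <- s) \int[m]_(x in D) f i x.
Proof.
move=> mD intf; elim: s => [|i s IH].
  rewrite big_nil; under eq_Rintegral do rewrite big_nil.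
  by rewrite Rintegral_cst// mul0r.
rewrite big_cons -IH; under eq_Rintegral do rewrite big_cons.
rewrite RintegralD//.
rewrite (_ : EFin \o _ = fun x => (\sum_(i <- s) (f i x)%:E)%E); last first.
  by apply/funext => x /=; rewrite sumEFin.
by apply: integrable_sum => // j _; exact: intf.
Qed.

Lemma normr_Rintegral_le (m : {measure set T -> \bar R}) (D : set T)
    (f : T -> R) (B : R) : measurable D -> (m D <= 1)%E -> 0 <= B ->
  m.-integrable D (EFin \o f) -> (forall x, D x -> `|f x| <= B) ->
  `|\int[m]_(x in D) f x| <= B.
Proof.
move=> mD mD1 B0 intf fB.
have mDoo : (m D < +oo)%E by rewrite (le_lt_trans mD1) ?ltry.
apply: (le_trans (le_normr_Rintegral _ _)) => //.
apply: (le_trans (le_Rintegral (f2 := fun=> B) _ _ _ _)) => //.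
- exact: (integrable_norm intf).
- exact/bounded_measurable_integrable/bounded_measurable_cst.
- rewrite Rintegral_cst// ler_piMr// -lee_fin fineK// ge0_fin_numE//.
Qed.

Lemma bounded_measurable_integrableP (P : probability T R) (f : T -> R) :
  bounded_measurable f -> P.-integrable setT (EFin \o f).
Proof.
move=> bf; apply: bounded_measurable_integrable => //.
by rewrite ltey_eq fin_num_measure.
Qed.

End bounded_measurable.

Lemma bounded_measurable_comp d (T : measurableType d) d' (T' : measurableType d')
    (R : realType) (f : T' -> R) (X : T -> T') : measurable_fun setT X ->
  bounded_measurable f -> bounded_measurable (fun t => f (X t)).
Proof.
move=> mX [mf [B fB]]; split; first exact: measurableT_comp.
by exists B => t; exact: fB.
Qed.

(** * Independence *)

Section independence.
Context d (T : measurableType d) (R : realType) (P : probability T R).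

Definition mfun_of d' (T' : measurableType d') (X : T -> T')
    (mX : measurable_fun setT X) : {mfun T >-> T'} :=
  HB.pack_for {mfun T >-> T'} X (isMeasurableFun.Build _ _ _ _ X mX).

Definition independent2 (X Z : T -> R) := forall A B : set R,
  measurable A -> measurable B ->
  P (X @^-1` A `&` Z @^-1` B) = (P (X @^-1` A) * P (Z @^-1` B))%E.

(** Independence is the equality of the joint law and the product law on rectangles; a product
    measure is determined by its values there. *)
Lemma independent2_prod (X Z : T -> R) (C : set (R * R))
    (mX : measurable_fun setT X) (mZ : measurable_fun setT Z) :
  independent2 X Z -> measurable C ->
  P ((fun t => (X t, Z t)) @^-1` C) =
  (distribution P (mfun_of mX) \x distribution P (mfun_of mZ))%E C.
Proof.
move=> iXZ mC.
have mXZ : measurable_fun setT (fun t => (X t, Z t)).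
  exact: measurable_fun_pair.
rewrite -[LHS]/(distribution P (mfun_of mXZ) C); apply/esym.
exact: product_measure_unique.
Qed.

(** Conditioning on [Z], expressed with two independent sample points [t] and [t'] of the same
    space. The integrability of the inner expectation is recorded because later steps split the
    outer integral by linearity. *)
Lemma independent2_Fubini (X Z : T -> R) (F : R * R -> R) :
  measurable_fun setT X -> measurable_fun setT Z ->
  independent2 X Z -> bounded_measurable F ->
  P.-integrable setT (EFin \o (fun t' => \int[P]_t F (X t, Z t'))) /\
  \int[P]_t F (X t, Z t) = \int[P]_t' \int[P]_t F (X t, Z t').
Proof.
move=> mX mZ iXZ bF.
have mXZ : measurable_fun setT (fun t => (X t, Z t)).
  exact: measurable_fun_pair.
pose PX := distribution P (mfun_of mX).
pose PZ := distribution P (mfun_of mZ).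
have PXZE C : measurable C ->
    (PX \x PZ)%E C = distribution P (mfun_of mXZ) C.
  by move=> mC; rewrite -independent2_prod.
have XZoo : ((PX \x PZ)%E setT < +oo)%E.
  by rewrite PXZE// /distribution /pushforward preimage_setT probability_setT ltry.
have intF : (PX \x PZ)%E.-integrable setT (EFin \o F).
  exact: bounded_measurable_integrable.
have GE z : fubini_G PX (EFin \o F) z = (\int[P]_t F (X t, z))%:E.
  have bFz : bounded_measurable (fun x => F (x, z)).
    by apply: (bounded_measurable_comp (X := fun x => (x, z))).
  have intFz := bounded_measurable_integrableP P (bounded_measurable_comp mX bFz).
  rewrite /fubini_G /PX integral_distribution//; last first.
    by apply/measurable_EFinP; case: bFz.
  by rewrite /Rintegral fineK//; exact: integrable_fin_num.
have mG : measurable_fun setT (fun z => \int[P]_t F (X t, z)).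
  have := measurable_fubini_G intF.
  by move=> /(eq_measurable_fun _ (fun z _ => GE z))/measurable_EFinP.
have [_ [B FB]] := bF.
have bG : bounded_measurable (fun z => \int[P]_t F (X t, z)).
  split => //; exists B => z; apply: normr_Rintegral_le => //.
  - exact: probability_le1.
  - exact: le_trans (FB (0, 0)).
  - apply: bounded_measurable_integrableP.
    apply: (bounded_measurable_comp (X := fun t => (X t, z))) => //.
    exact: measurable_fun_pair.
have intG := bounded_measurable_integrableP P (bounded_measurable_comp mZ bG).
split=> //.
have := integral21_prod_meas1 intF.
under eq_integral do rewrite GE.
rewrite /PZ integral_distribution//; last exact/measurable_EFinP.
rewrite (eq_measure_integral (distribution P (mfun_of mXZ))); last first.
  by move=> A mA _; exact: PXZE.
rewrite integral_distribution//.
- by rewrite /Rintegral => ->.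
- by apply/measurable_EFinP; case: bF.
- exact: (bounded_measurable_integrableP P (bounded_measurable_comp mXZ bF)).
Qed.

End independence.

(** * Independence of one variable and the sum of others *)

Section independence_of_sums.
Context d (T : measurableType d) (R : realType) (P : probability T R).

(** The restriction of [P] to [E] and the multiple of [P] by [P E], both transported by [(X, Z)],
    are finite measures that agree on rectangles, a family stable under intersection that generates
    the product sigma-algebra. *)
Lemma independent_event_prod (X Z : T -> R) (E : set T) :
  measurable_fun setT X -> measurable_fun setT Z -> measurable E ->
  (forall A B : set R, measurable A -> measurable B ->
    P (X @^-1` A `&` Z @^-1` B `&` E) =
    (P (X @^-1` A `&` Z @^-1` B) * P E)%E) ->
  forall C : set (R * R), measurable C ->
  P ((fun t => (X t, Z t)) @^-1` C `&` E) =
  (P ((fun t => (X t, Z t)) @^-1` C) * P E)%E.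
Proof.
move=> mX mZ mE rect C mC.
have mXZ : measurable_fun setT (fun t => (X t, Z t)).
  exact: measurable_fun_pair.
pose p : {nonneg R} := NngNum (fine_ge0 (measure_ge0 P E)).
have pE : (p%:num)%:E = P E by rewrite /= fineK// fin_num_measure.
pose m1 := pushforward (mrestr P mE) (mfun_of mXZ).
pose m2 := mscale p (distribution P (mfun_of mXZ)).
suff : m1 C = m2 C by rewrite -pE muleC.
pose G : set (set (R * R)) :=
  [set C | exists A, measurable A /\ exists B, measurable B /\ C = A `*` B].
apply: (measure_unique G (fun=> setT)) => //.
- rewrite measurable_prod_measurableType //; congr (<<s _ >>).
  rewrite predeqE; split => [[A mA [B mB <-]]|[A [mA [B [mB ->]]]]].
    by exists A; split => //; exists B.
  by exists A => //; exists B.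
- move=> _ _ [X1 [mX1 [X2 [mX2 ->]]]] [Y1 [mY1 [Y2 [mY2 ->]]]].
  rewrite -setXI; exists (X1 `&` Y1); split; first exact: measurableI.
  by exists (X2 `&` Y2); split => //; exact: measurableI.
- by move=> _; exists setT; split => //; exists setT; split; rewrite ?setXTT.
- by rewrite bigcup_const//; exists 0%N.
- move=> _ [A [mA [B [mB ->]]]].
  by move: (rect _ _ mA mB); rewrite -pE muleC.
- move=> _; rewrite -[X in (X < _)%E]/(P (setT `&` E)) setTI.
  by rewrite ltey_eq fin_num_measure.
Qed.

Context (Y : nat -> {RV P >-> R}) (Y_indep : mutually_independent Y).

Definition seq_sum (s : seq nat) (t : T) : R := \sum_(i <- s) Y i t.

Lemma measurable_seq_sum s : measurable_fun setT (seq_sum s).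
Proof. exact: measurable_sum. Qed.

Lemma measurable_preimage (X : T -> R) (A : set R) :
  measurable_fun setT X -> measurable A -> measurable (X @^-1` A).
Proof. by move=> mX mA; rewrite -[X in measurable X]setTI; exact: mX. Qed.

(** The events indexed by [u] are there for the induction on [s]: when [i] is added to the sum, the
    event on [Y i] joins the list, and the induction hypothesis for [[:: i]] and for [i :: u] gives
    the product rule on rectangles for the pair ([Y i], rest of the sum). *)
Lemma seq_sum_independent_events (s u : seq nat) (A : nat -> set R) (B : set R) :
  uniq (s ++ u) -> (forall i, measurable (A i)) -> measurable B ->
  P (seq_sum s @^-1` B `&` \bigcap_(i in [set` u]) (Y i @^-1` A i)) =
  (P (seq_sum s @^-1` B) * \prod_(i <- u) P (Y i @^-1` A i))%E.
Proof.
elim: s u A B => [|i s IH] u A B.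
  (* The empty sum is the constant 0, so its event is either everything or empty. *)
  move=> /= uu mA mB; have [B0|B0] := pselect (B 0).
    rewrite (_ : _ @^-1` B = setT) ?setTI ?probability_setT ?mul1e//.
      exact: Y_indep.
    by apply/seteqP; split => // t _; rewrite /seq_sum /= big_nil.
  rewrite (_ : _ @^-1` B = set0) ?set0I ?measure0 ?mul0e//.
  by apply/seteqP; split => // t; rewrite /seq_sum /= big_nil.
move=> isu mA mB.
have /andP[iNsu su] : (i \notin s ++ u) && uniq (s ++ u) by [].
have uu : uniq u by move: su; rewrite cat_uniq => /and3P[].
have us : uniq s by move: su; rewrite cat_uniq => /and3P[].
have [iNs iNu] : i \notin s /\ i \notin u.
  by move: iNsu; rewrite mem_cat negb_or => /andP[].
pose E := \bigcap_(j in [set` u]) (Y j @^-1` A j).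
have mE : measurable E.
  by apply: bigcap_measurableType => // j _; exact: measurable_preimage.
have PE : P E = (\prod_(j <- u) P (Y j @^-1` A j))%E by exact: Y_indep.
have rect A1 B1 : measurable A1 -> measurable B1 ->
    P (Y i @^-1` A1 `&` seq_sum s @^-1` B1) =
      (P (seq_sum s @^-1` B1) * P (Y i @^-1` A1))%E /\
    P (Y i @^-1` A1 `&` seq_sum s @^-1` B1 `&` E) =
      (P (seq_sum s @^-1` B1) * P (Y i @^-1` A1) * P E)%E.
  move=> mA1 mB1; split.
    have := IH [:: i] (fun=> A1) B1.
    rewrite big_seq1 set_cons1 bigcap_set1 setIC; apply => //.
    by rewrite cat_uniq us /= orbF iNs.
  (* Since [i] is not in [u], the value at [i] can be chosen freely without touching the events of
     [u]. *)
  pose A' j := if j == i then A1 else A j.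
  have mA' j : measurable (A' j) by rewrite /A'; case: ifP.
  have A'E j : j \in u -> A' j = A j.
    by move=> ju; rewrite /A'; case: eqP => // ji; rewrite -ji ju in iNu.
  have A'i : A' i = A1 by rewrite /A' eqxx.
  have bE : \bigcap_(j in [set` i :: u]) (Y j @^-1` A' j) = Y i @^-1` A1 `&` E.
    apply/seteqP; split => t.
      move=> At; split; first by rewrite -A'i; apply: At => /=; rewrite mem_head.
      by move=> j /= ju; rewrite -A'E//; apply: At; rewrite /= inE ju orbT.
    move=> [Ait Et] j /=; rewrite inE => /predU1P[->|ju]; first by rewrite A'i.
    by rewrite A'E//; exact: Et.
  have := IH (i :: u) A' B1.
  rewrite big_cons bE A'i.
  rewrite (eq_big_seq (fun j => P (Y j @^-1` A j))); last first.
    by move=> j /A'E ->.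
  rewrite setIA (setIC (seq_sum s @^-1` B1)) -PE muleA; apply => //.
  by rewrite -cat1s uniq_catCA.
have mS := measurable_seq_sum s.
have mC : measurable [set x : R * R | B (x.1 + x.2)].
  rewrite -[X in measurable X]setTI.
  by apply: (measurable_funD (f := fst) (g := snd)) => //.
have sumE : seq_sum (i :: s) @^-1` B =
    (fun t => (Y i t, seq_sum s t)) @^-1` [set x : R * R | B (x.1 + x.2)].
  by apply/seteqP; split => t; rewrite /seq_sum /= big_cons.
rewrite -PE sumE; apply: independent_event_prod => // A1 B1 mA1 mB1.
by have [-> ->] := rect _ _ mA1 mB1.
Qed.

Lemma independent2_seq_sum (i : nat) (s : seq nat) : uniq (i :: s) ->
  independent2 P (Y i) (seq_sum s).
Proof.
move=> /= /andP[iNs us] A B mA mB.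
have := @seq_sum_independent_events s [:: i] (fun=> A) B.
rewrite big_seq1 set_cons1 bigcap_set1 setIC muleC; apply => //.
by rewrite cat_uniq us /= orbF iNs.
Qed.

End independence_of_sums.

(** * Densities and reduction modulo 1 *)

Section density.
Context d (T : measurableType d) (R : realType) (P : probability T R).
Local Notation mu := (@lebesgue_measure R).

(** The Radon-Nikodym derivative of the law of [X] has the same integral over every measurable set
    as [g] extended by 0, so the two agree almost everywhere; the change of variables formula then
    passes from events to functions. *)
Lemma density_Rintegral (X : T -> R) (g f : R -> R) :
  measurable_fun setT X -> has_density01 P X g -> bounded_measurable f ->
  \int[P]_t f (X t) = \int[mu]_(x in `[0, 1]) (f x * g x).
Proof.
move=> mX [_ intg g0 PXE] bf.
(* Lebesgue measure is sigma-finite over [measurableTypeR R], whose measurable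
   structure is convertible to that of [R] but is not found from [R]. *)
have mX' : measurable_fun setT (X : T -> measurableTypeR R) by exact: mX.
pose nu := distribution P (mfun_of mX').
pose g1 := (EFin \o g) \_ `[0, 1]%classic.
have mI : measurable (`[0, 1]%classic : set (measurableTypeR R)) by [].
have intg1 : mu.-integrable setT g1.
  exact: (iffLR (@integrable_mkcond _ _ _ mu _ (EFin \o g) mI)).
have mg1 : measurable_fun setT g1 by exact: (measurable_int mu intg1).
have nuE A : measurable A -> nu A = (\int[mu]_(x in A) g1 x)%E.
  by move=> mA; rewrite /nu /g1 -integral_mkcondr -PXE.
have numu : nu `<< mu.
  apply/null_content_dominatesP => A mA A0; rewrite nuE//.
  by apply: null_set_integral => //; exact: measurable_funTS.
pose D := Radon_Nikodym (charge_of_finite_measure nu) mu.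
have D_ae : ae_eq mu setT D g1.
  apply: integral_ae_eq => //.
  - exact: Radon_Nikodym_integrable.
  - by move=> E _ mE; rewrite -nuE// -Radon_Nikodym_integral.
have intfX := bounded_measurable_integrableP P (bounded_measurable_comp mX bf).
have mf : measurable_fun setT (EFin \o f) by apply/measurable_EFinP; case: bf.
have intf : nu.-integrable setT (EFin \o f).
  exact: (bounded_measurable_integrableP nu bf).
congr fine.
have := integral_distribution (X := mfun_of mX') mf intfX.
move=> /= <-; rewrite -(Radon_Nikodym_change_of_variables numu)//.
rewrite -/D [RHS]integral_mkcond.
have -> : ((fun x => (f x * g x)%:E) \_ `[0, 1]%classic) =
    (fun x => ((f x)%:E * g1 x)%E).
  apply/funext => x; rewrite /g1 !patchE; case: ifP => _.
    by rewrite EFinM.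
  by rewrite mule0.
apply: ae_eq_integral => //.
- apply: emeasurable_funM => //; apply: (measurable_int mu).
  exact: Radon_Nikodym_integrable.
- exact: emeasurable_funM.
- by apply: filterS D_ae => x /= /[apply] ->.
Qed.

End density.

(** * Rotations modulo 1 preserve Lebesgue measure *)

Section mod1.
Context (R : realType).
Local Notation mu := (@lebesgue_measure R).
Implicit Types x y z r : R.

Lemma mod1E x r (k : int) : 0 <= r < 1 -> x = r + k%:~R -> mod1 x = r.
Proof.
move=> /andP[r0 r1] ->; rewrite /mod1 (@floor_def _ _ k) ?addrK//.
by rewrite intrD lerDr r0 addrC ltrD2l.
Qed.

Lemma mod1_itv x : 0 <= mod1 x < 1.
Proof.
have /andP[] := floor_itv x; rewrite /mod1 intrD => fx xf.
by rewrite subr_ge0 fx ltrBlDl.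
Qed.

Lemma mod1_addr_mod1 x y : mod1 (x + mod1 y) = mod1 (x + y).
Proof.
apply: (@mod1E _ _ (Num.floor (x + y) - Num.floor y)); first exact: mod1_itv.
by rewrite intrB /mod1; ring.
Qed.

Lemma measurable_mod1 : measurable_fun setT (@mod1 R).
Proof.
apply: measurable_funB => //; apply: nondecreasing_measurable => // x y xy.
by rewrite ler_int le_floor.
Qed.

Lemma lebesgue_measure_translate z (A : set R) : measurable A ->
  mu ((fun x => x + z) @^-1` A) = mu A.
Proof.
move=> mA.
have mz : measurable_fun setT
    (fun x : measurableTypeR R => (x + z : measurableTypeR R)).
  exact: measurable_funD.
apply/esym; rewrite -[RHS]/(pushforward mu (mfun_of mz) A).
apply: lebesgue_measure_unique => // _ [[a b]] _ <-.
rewrite [RHS](_ : _ = mu (`]a - z, b - z]%classic : set R)); last first.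
  by congr (mu _); apply/seteqP; split => x /=; rewrite !in_itv/=; lra.
rewrite [RHS]lebesgue_measure_itv lebesgue_measure_itv/= !lte_fin ltrD2r.
by case: ifP => // _; congr EFin; lra.
Qed.

(** The rotation cuts [A] at [w]: points of [A] in [w, 1[ come from a translation by w, those in [0,
    w[ from a translation by w - 1. Both pieces keep their measure, and the two preimages are
    disjoint. *)
Lemma lebesgue_measure_mod1 z (A : set R) : measurable A -> A `<=` `[0, 1[ ->
  mu ([set x | A (mod1 (x + z))] `&` `[0, 1[) = mu A.
Proof.
move=> mA A01; pose w := mod1 z.
have /andP[w0 w1] : 0 <= w < 1 by exact: mod1_itv.
pose A1 := A `&` `[w, 1[; pose A2 := A `&` `[0, w[.
have mshift c : measurable_fun setT (fun x : R => x + c).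
  exact: measurable_funD.
have mA1 : measurable A1 by exact: measurableI.
have mA2 : measurable A2 by exact: measurableI.
have -> : [set x | A (mod1 (x + z))] `&` `[0, 1[ =
    ((fun x => x + w) @^-1` A1) `|` ((fun x => x + (w - 1)) @^-1` A2).
  apply/seteqP; split => x; rewrite /A1 /A2 /= !in_itv/=.
    rewrite -mod1_addr_mod1 -/w => -[Ax /andP[x0 x1]].
    have [xw|xw] := ltP (x + w) 1.
      left; rewrite (@mod1E _ (x + w) 0) ?addr0 in Ax; last 2 first.
      - by apply/andP; split => //; lra.
      - by [].
      by split => //; lra.
    right; rewrite (@mod1E _ (x + (w - 1)) 1) in Ax; last 2 first.
    - by apply/andP; split; lra.
    - by lra.
    by split => //; lra.
  rewrite -mod1_addr_mod1 -/w => -[[Ax xw]|[Ax xw]].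
    rewrite (@mod1E _ (x + w) 0) ?addr0//; last by lra.
    by split => //; lra.
  rewrite (@mod1E _ (x + (w - 1)) 1)//; [|lra|lra].
  by split => //; lra.
rewrite measureU; last 3 first.
- exact: (measurable_preimage (mshift w) mA1).
- exact: (measurable_preimage (mshift (w - 1)) mA2).
- apply/seteqP; split => // x; rewrite /A1 /A2 /= !in_itv/=; lra.
transitivity (mu A1 + mu A2)%E.
  by congr (_ + _)%E; exact: lebesgue_measure_translate.
rewrite -measureU//; last first.
  apply/seteqP; split => // x; rewrite /A1 /A2 /= !in_itv/=; lra.
congr (mu _); rewrite /A1 /A2 -setIUr; apply/setIidPl => x /A01 /=.
rewrite !in_itv/=; have [] := ltP x w; [right|left]; lra.
Qed.

Lemma Rintegral_itvco_cc (f : R -> R) :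
  mu.-integrable `[0, 1[ (EFin \o f) ->
  \int[mu]_(x in `[0, 1]) f x = \int[mu]_(x in `[0, 1[) f x.
Proof. by move=> intf; rewrite Rintegral_itv_bndo_bndc. Qed.

Lemma Rintegral_mod1 z (f : R -> R) : bounded_measurable f ->
  \int[mu]_(x in `[0, 1]) f (mod1 (x + z)) = \int[mu]_(x in `[0, 1]) f x.
Proof.
move=> bf.
have mz : measurable_fun setT (fun x => mod1 (x + z)).
  by apply: (measurableT_comp measurable_mod1); exact: measurable_funD.
have I_fin : (mu (`[0%R, 1%R[ : set R) < +oo)%E.
  by rewrite lebesgue_measure_itv /= lte01 oppr0 adde0 ltry.
(* [phi] is the translation modulo 1, modified so that it maps the complement of
   [0, 1[ outside of [0, 1[. *)
pose phi x : measurableTypeR R :=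
  mod1 (x + z) + (1 - \1_(`[0, 1[%classic : set R) x) * 2.
have mphi : measurable_fun setT (phi : measurableTypeR R -> _).
  apply: measurable_funD => //; apply: measurable_funM => //.
  by apply: measurable_funB => //; exact: measurable_indic.
have phiE x : 0 <= x < 1 -> phi x = mod1 (x + z).
  move=> x01; rewrite /phi indicE mem_set/= ?in_itv//=.
  by rewrite subrr mul0r addr0.
have phi_pre : phi @^-1` `[0, 1[ = (`[0, 1[%classic : set R).
  apply/seteqP; split => x /=; rewrite !in_itv/=; last first.
    by move=> x01; rewrite phiE// mod1_itv.
  apply: contraPT => x01; rewrite /phi indicE memNset/= ?in_itv//=; last exact/negP.
  by have := mod1_itv (x + z); lra.
rewrite !Rintegral_itvco_cc; last 2 first.
- by apply: bounded_measurable_integrable.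
- apply: bounded_measurable_integrable => //.
  exact: (bounded_measurable_comp mz).
congr fine.
(* Only measurable sets inside [0, 1[ have to be compared, which is the case settled by
   [lebesgue_measure_mod1]. *)
rewrite [RHS](eq_measure_integral (pushforward mu (mfun_of mphi))); last first.
  move=> A mA A01; rewrite -[LHS](lebesgue_measure_mod1 z mA A01).
  congr (mu _); apply/seteqP; split => x /=.
    by rewrite in_itv/= => -[Ax x01]; rewrite phiE.
  move=> Ax; have : (phi @^-1` `[0, 1[) x by exact: A01.
  by rewrite phi_pre /= in_itv/= => x01; split => //; rewrite -phiE.
rewrite integral_pushforward//.
- rewrite phi_pre; apply: eq_integral => x; rewrite inE/= in_itv/= => x01.
  by rewrite phiE.
- by apply/measurable_EFinP; case: bf.
- rewrite [X in _.-integrable X _]phi_pre.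
  apply: bounded_measurable_integrable => //.
  exact: (bounded_measurable_comp mphi bf).
Qed.

End mod1.

(** * Fejer means *)

Section trigonometric_system.
Context (R : realType).
Local Notation mu := (@lebesgue_measure R).
Implicit Types (x y : R) (n m : int).

Definition tcos n x : R := cos (2 * pi * n%:~R * x).
Definition tsin n x : R := sin (2 * pi * n%:~R * x).

Lemma cos2pin_sin2pin (m : nat) :
  cos (2 * pi * m%:R) = 1 :> R /\ sin (2 * pi * m%:R) = 0 :> R.
Proof.
have -> : 2 * pi * m%:R = 0 + pi *+ 2 *+ m :> R.
  by rewrite add0r -(mulr_natr (pi *+ 2)) -(mulr_natl pi).
by rewrite (periodicn (@cosD2pi R)) (periodicn (@sinD2pi R)) cos0 sin0.
Qed.

Lemma cos2piz_sin2piz m :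
  cos (2 * pi * m%:~R) = 1 :> R /\ sin (2 * pi * m%:~R) = 0 :> R.
Proof.
case: m => m; first exact: cos2pin_sin2pin.
have [c s] := cos2pin_sin2pin m.+1.
by rewrite NegzE mulrNz mulrN cosN sinN c s oppr0.
Qed.

Lemma tcosD n x y : tcos n (x + y) = tcos n x * tcos n y - tsin n x * tsin n y.
Proof. by rewrite /tcos mulrDr cosD. Qed.

Lemma tsinD n x y : tsin n (x + y) = tsin n x * tcos n y + tcos n x * tsin n y.
Proof. by rewrite /tsin mulrDr sinD. Qed.

Lemma tcosB n x y : tcos n (x - y) = tcos n x * tcos n y + tsin n x * tsin n y.
Proof. by rewrite /tcos mulrBr cosB. Qed.

Lemma tcosz n m : tcos n m%:~R = 1.
Proof. by rewrite /tcos -mulrA -intrM (cos2piz_sin2piz _).1. Qed.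

Lemma tsinz n m : tsin n m%:~R = 0.
Proof. by rewrite /tsin -mulrA -intrM (cos2piz_sin2piz _).2. Qed.

Lemma tcos_mod1 n x : tcos n (mod1 x) = tcos n x.
Proof. by rewrite /mod1 tcosB tcosz tsinz mulr1 mulr0 addr0. Qed.

Lemma tsin_mod1 n x : tsin n (mod1 x) = tsin n x.
Proof.
by rewrite /mod1 -mulrNz tsinD tcosz tsinz mulr1 mulr0 addr0.
Qed.

Lemma tcos0 x : tcos 0 x = 1.
Proof. by rewrite /tcos mulr0z mulr0 mul0r cos0. Qed.

Lemma tsin0 x : tsin 0 x = 0.
Proof. by rewrite /tsin mulr0z mulr0 mul0r sin0. Qed.

Lemma tcos_subz n m x : tcos (n - m) x = tcos n x * tcos m x + tsin n x * tsin m x.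
Proof. by rewrite /tcos /tsin intrB mulrBr mulrBl cosB. Qed.

Lemma tcosM1 n x : tcos n x * tcos 1 x = (tcos (n - 1) x + tcos (n + 1) x) / 2.
Proof.
have -> : tcos (n + 1) x = tcos n x * tcos 1 x - tsin n x * tsin 1 x.
  by rewrite /tcos /tsin intrD [X in X * x]mulrDr mulrDl cosD.
by rewrite tcos_subz; lra.
Qed.

Lemma normr_tcos_le1 n x : `|tcos n x| <= 1. Proof. exact: cos_max. Qed.

Lemma normr_tsin_le1 n x : `|tsin n x| <= 1. Proof. exact: sin_max. Qed.

Lemma continuous_tcos n : continuous (tcos n).
Proof.
move=> x; apply: continuous_comp; last exact: continuous_cos.
exact: mulrl_continuous.
Qed.

Lemma continuous_tsin n : continuous (tsin n).
Proof.
move=> x; apply: continuous_comp; last exact: continuous_sin.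
exact: mulrl_continuous.
Qed.

Lemma bounded_measurable_tcos n : bounded_measurable (tcos n).
Proof.
split; first by apply: continuous_measurable_fun; exact: continuous_tcos.
by exists 1; exact: normr_tcos_le1.
Qed.

Lemma bounded_measurable_tsin n : bounded_measurable (tsin n).
Proof.
split; first by apply: continuous_measurable_fun; exact: continuous_tsin.
by exists 1; exact: normr_tsin_le1.
Qed.

Lemma tcos_half_period n x : n != 0 -> tcos n (x + (2 * n%:~R)^-1) = - tcos n x.
Proof.
move=> n0; rewrite /tcos mulrDr (_ : _ * (2 * n%:~R)^-1 = pi) ?cosDpi//.
by field; rewrite intr_eq0.
Qed.

Lemma tsin_half_period n x : n != 0 -> tsin n (x + (2 * n%:~R)^-1) = - tsin n x.
Proof.
move=> n0; rewrite /tsin mulrDr (_ : _ * (2 * n%:~R)^-1 = pi) ?sinDpi//.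
by field; rewrite intr_eq0.
Qed.

Lemma lebesgue_measure_01 : mu (`[0%R, 1%R] : set R) = 1%E.
Proof. by rewrite lebesgue_measure_itv /= lte01 oppr0 adde0. Qed.

Lemma bounded_measurable_integrable01 (f : R -> R) :
  bounded_measurable f -> mu.-integrable `[0, 1] (EFin \o f).
Proof.
move=> bf; apply: bounded_measurable_integrable => //.
by have := lebesgue_measure_01 => /= ->; rewrite ltry.
Qed.

Lemma Rintegral01_cst (c : R) : \int[mu]_(x in `[0, 1]) c = c.
Proof.
rewrite Rintegral_cst// [X in fine X](_ : _ = 1%E) ?mulr1//.
exact: lebesgue_measure_01.
Qed.

(* Translating by half a period changes the sign of the integral. *)
Lemma Rintegral01_tcos n : \int[mu]_(x in `[0, 1]) tcos n x = (n == 0)%:R.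
Proof.
have [->|n0] := eqVneq n 0.
  under eq_Rintegral do rewrite tcos0.
  exact: Rintegral01_cst.
have := Rintegral_mod1 (2 * n%:~R)^-1 (bounded_measurable_tcos n).
under eq_Rintegral do rewrite tcos_mod1 (tcos_half_period _ n0) -mulN1r.
rewrite RintegralZl//; first by move=> /= ?; lra.
exact: bounded_measurable_integrable01 (bounded_measurable_tcos n).
Qed.

Lemma Rintegral01_tsin n : \int[mu]_(x in `[0, 1]) tsin n x = 0.
Proof.
have [->|n0] := eqVneq n 0.
  under eq_Rintegral do rewrite tsin0.
  exact: Rintegral01_cst.
have := Rintegral_mod1 (2 * n%:~R)^-1 (bounded_measurable_tsin n).
under eq_Rintegral do rewrite tsin_mod1 (tsin_half_period _ n0) -mulN1r.
rewrite RintegralZl//; first by move=> /= ?; lra.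
exact: bounded_measurable_integrable01 (bounded_measurable_tsin n).
Qed.

End trigonometric_system.

(** * The Fejer kernel and its moments *)

Section fejer.
Context (R : realType).
Local Notation mu := (@lebesgue_measure R).
Implicit Types (x y : R) (k : nat) (f g : R -> R).

(** A frequency n with |n| < k is attained by k - |n| pairs, so summing over pairs encodes the
    triangular weights 1 - |n|/k of the Fejer kernel as multiplicities. *)
Definition freq k (p : 'I_k * 'I_k) : int := p.1%:Z - p.2%:Z.

(* [fejer k x] is |sum_(j < k) e^(2 i pi j x)|^2 / k, expanded. *)
Definition fejer k x : R := k%:R^-1 * \sum_(p : 'I_k * 'I_k) tcos (freq p) x.

Definition fejer_mean k g y : R :=
  \int[mu]_(x in `[0, 1]) (fejer k (y - x) * g x).

(** Up to the factor 1/k, the double sum is the squared modulus of a sum of exponentials, hence a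
    sum of two squares. *)
Lemma fejer_ge0 k x : 0 <= fejer k x.
Proof.
rewrite /fejer mulr_ge0 ?invr_ge0//.
rewrite -(pair_bigA _ (fun i j => tcos (freq (i, j)) x))/=.
suff -> : \sum_(i < k) \sum_(j < k) tcos (freq (i, j)) x =
    (\sum_(i < k) tcos i%:Z x) ^+ 2 + (\sum_(i < k) tsin i%:Z x) ^+ 2.
  by rewrite addr_ge0 ?sqr_ge0.
rewrite !expr2 !big_distrl -big_split/=; apply: eq_bigr => i _.
rewrite !big_distrr -big_split/=; apply: eq_bigr => j _.
by rewrite tcos_subz.
Qed.

Lemma bounded_measurable_tcos_sub n y :
  bounded_measurable (fun x : R => tcos n (y - x)).
Proof.
apply: (bounded_measurable_comp (X := fun x => y - x)).
  exact: measurable_funB.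
exact: bounded_measurable_tcos.
Qed.

Lemma bounded_measurable_fejer_sub k y :
  bounded_measurable (fun x => fejer k (y - x)).
Proof.
apply: bounded_measurableM; first exact: bounded_measurable_cst.
by apply: bounded_measurable_sum => p; exact: bounded_measurable_tcos_sub.
Qed.

Lemma Rintegral_tcos_sub n y g : mu.-integrable `[0, 1] (EFin \o g) ->
  \int[mu]_(x in `[0, 1]) (tcos n (y - x) * g x) =
  tcos n y * (\int[mu]_(x in `[0, 1]) (tcos n x * g x)) +
  tsin n y * (\int[mu]_(x in `[0, 1]) (tsin n x * g x)).
Proof.
move=> intg.
have mI : measurable (`[0%R, 1%R]%classic : set (measurableTypeR R)) by [].
have intc := bounded_measurable_mul_integrable mI intg (bounded_measurable_tcos R n).
have ints := bounded_measurable_mul_integrable mI intg (bounded_measurable_tsin R n).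
rewrite -!RintegralZl// -RintegralD//; last 2 first.
- exact: (integrableZl _ _ intc).
- exact: (integrableZl _ _ ints).
by apply: eq_Rintegral => x _; rewrite tcosB mulrDl !mulrA.
Qed.

(** Separating [y] from the integration variable shows that the mean is a trigonometric polynomial
    in [y]. Its measurability, its periodicity and its integral are read off this form, without
    exchanging two Lebesgue integrals. *)
Lemma fejer_meanE k g y : mu.-integrable `[0, 1] (EFin \o g) ->
  fejer_mean k g y = k%:R^-1 * \sum_(p : 'I_k * 'I_k)
  (tcos (freq p) y * (\int[mu]_(x in `[0, 1]) (tcos (freq p) x * g x)) +
   tsin (freq p) y * (\int[mu]_(x in `[0, 1]) (tsin (freq p) x * g x))).
Proof.
move=> intg.
have mI : measurable (`[0%R, 1%R]%classic : set (measurableTypeR R)) by [].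
under [in RHS]eq_bigr do rewrite -Rintegral_tcos_sub//.
have intp (p : 'I_k * 'I_k) : mu.-integrable `[0, 1]
    (EFin \o (fun x => tcos (freq p) (y - x) * g x)).
  exact: (bounded_measurable_mul_integrable mI intg
    (bounded_measurable_tcos_sub (freq p) y)).
rewrite -Rintegral_sum// -RintegralZl//; last first.
  rewrite (_ : EFin \o _ = EFin \o (fun x =>
      (\sum_(p : 'I_k * 'I_k) tcos (freq p) (y - x)) * g x)); last first.
    by apply/funext => x /=; rewrite mulr_suml.
  apply: (bounded_measurable_mul_integrable mI intg).
  by apply: bounded_measurable_sum => p; exact: bounded_measurable_tcos_sub.
by apply: eq_Rintegral => x _; rewrite /fejer -mulrA mulr_suml.
Qed.

Lemma sum_freq_eq0 k : \sum_(p : 'I_k * 'I_k) (freq p == 0)%:R = k%:R :> R.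
Proof.
rewrite -(pair_bigA _ (fun i j => (freq (i, j) == 0)%:R))/=.
rewrite (eq_bigr (fun=> 1)); first by rewrite sumr_const card_ord.
move=> i _; rewrite (bigD1 i)//= /freq/= subrr eqxx big1 ?addr0// => j ji.
by rewrite subr_eq0 eqz_nat (inj_eq val_inj) eq_sym (negbTE ji).
Qed.

Lemma sum_freq_eq1 k : (0 < k)%N ->
  \sum_(p : 'I_k * 'I_k) (freq p == 1)%:R = k%:R - 1 :> R.
Proof.
case: k => // k _.
(* Row 0 only has frequencies at most 0; row i + 1 meets the frequency 1 exactly at column i. This
   leaves k - 1 pairs. *)
rewrite -(pair_bigA _ (fun i j => (freq (i, j) == 1)%:R))/= big_ord_recl/=.
rewrite big1 ?add0r; last first.
  by move=> j _; rewrite /freq/=; case: eqP => //; lia.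
rewrite (eq_bigr (fun=> 1)); first by rewrite sumr_const card_ord -natr1 addrK.
move=> i _; rewrite (bigD1 (widen_ord (leqnSn k) i))//= big1 ?addr0.
  by rewrite /freq /= /bump /=; case: eqP => //; lia.
move=> j; rewrite /freq /= /bump /= => ji; case: eqP => // ij.
by case/eqP: ji; apply/val_inj => /=; lia.
Qed.

Lemma sum_freq_eqN1 k : (0 < k)%N ->
  \sum_(p : 'I_k * 'I_k) (freq p == -1)%:R = k%:R - 1 :> R.
Proof.
move=> k0; rewrite -sum_freq_eq1//.
rewrite (reindex (fun p : 'I_k * 'I_k => (p.2, p.1)))/=.
  by apply: eq_bigr => p _; rewrite /freq/= -opprB eqr_opp.
by exists (fun p => (p.2, p.1)) => -[].
Qed.

Lemma Rintegral_fejer_sub k y : (0 < k)%N ->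
  \int[mu]_(x in `[0, 1]) fejer k (y - x) = 1.
Proof.
move=> k0; have := @fejer_meanE k (fun=> 1) y.
rewrite /fejer_mean; under eq_Rintegral do rewrite mulr1.
under eq_bigr do under eq_Rintegral do rewrite mulr1.
move=> ->; last first.
  by apply: bounded_measurable_integrable01; exact: bounded_measurable_cst.
under eq_bigr => p _.
  under [X in _ + _ * X]eq_Rintegral do rewrite mulr1.
  rewrite Rintegral01_tcos Rintegral01_tsin mulr0 addr0.
  rewrite (_ : _ * _ = (freq p == 0)%:R); last first.
    by case: eqP => [->|]; rewrite ?tcos0 ?mulr1 ?mulr0.
  over.
by rewrite /= sum_freq_eq0 mulVf// pnatr_eq0 -lt0n.
Qed.

(** Multiplying by the cosine of frequency 1 shifts frequencies by 1 in both directions, with weight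
    1/2. Only pairs of frequency 1 or -1 then survive, k - 1 of each, whence (k - 1)/k. *)
Lemma Rintegral_fejer_tcos1_sub k y : (0 < k)%N ->
  \int[mu]_(x in `[0, 1]) (fejer k (y - x) * tcos 1 (y - x)) = 1 - k%:R^-1.
Proof.
move=> k0.
have mI : measurable (`[0%R, 1%R]%classic : set (measurableTypeR R)) by [].
have kN0 : k%:R != 0 :> R by rewrite pnatr_eq0 -lt0n.
have tE n : \int[mu]_(x in `[0, 1]) tcos n (y - x) = (n == 0)%:R.
  have := @Rintegral_tcos_sub n y (fun=> 1).
  under eq_Rintegral do rewrite mulr1.
  under [X in _ * X + _]eq_Rintegral do rewrite mulr1.
  under [X in _ + _ * X]eq_Rintegral do rewrite mulr1.
  rewrite Rintegral01_tcos Rintegral01_tsin mulr0 addr0 => ->.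
    by case: eqP => [->|]; rewrite ?tcos0 ?mulr1 ?mulr0.
  by apply: bounded_measurable_integrable01; exact: bounded_measurable_cst.
have intt n := bounded_measurable_integrable01 (bounded_measurable_tcos_sub n y).
rewrite (_ : 1 - _ = k%:R^-1 * \sum_(p : 'I_k * 'I_k)
   \int[mu]_(x in `[0, 1]) ((tcos (freq p - 1) (y - x) +
     tcos (freq p + 1) (y - x)) * 2^-1)); last first.
  under eq_bigr => p _.
    rewrite RintegralZr//; last exact: (integrableD _ (intt _) (intt _)).
    rewrite RintegralD// !tE subr_eq0 addr_eq0.
    over.
  rewrite -mulr_suml big_split /= sum_freq_eq1// sum_freq_eqN1//.
  by field.
have intp (p : 'I_k * 'I_k) : mu.-integrable `[0, 1]
    (EFin \o (fun x =>
      (tcos (freq p - 1) (y - x) + tcos (freq p + 1) (y - x)) * 2^-1)).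
  apply: bounded_measurable_integrable01; apply: bounded_measurableM.
    by apply: bounded_measurableD; exact: bounded_measurable_tcos_sub.
  exact: bounded_measurable_cst.
rewrite -Rintegral_sum// -RintegralZl//; last first.
  apply: bounded_measurable_integrable01.
  apply: bounded_measurable_sum => p; apply: bounded_measurableM.
    by apply: bounded_measurableD; exact: bounded_measurable_tcos_sub.
  exact: bounded_measurable_cst.
apply: eq_Rintegral => x _; rewrite /fejer -mulrA mulr_suml.
by congr (_ * _); apply: eq_bigr => p _; rewrite tcosM1.
Qed.

End fejer.

(** * Contraction in L1 and the Korovkin estimate *)

Section fejer_convergence.
Context (R : realType).
Local Notation mu := (@lebesgue_measure R).
Implicit Types (x y : R) (k : nat) (f g u : R -> R).

Let mI : measurable (`[0%R, 1%R]%classic : set (measurableTypeR R)).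
Proof. by []. Qed.

Lemma bounded_measurable_fejer_mean k g : mu.-integrable `[0, 1] (EFin \o g) ->
  bounded_measurable (fejer_mean k g).
Proof.
move=> intg.
rewrite (_ : fejer_mean k g = fun y => k%:R^-1 * \sum_(p : 'I_k * 'I_k)
  (tcos (freq p) y * (\int[mu]_(x in `[0, 1]) (tcos (freq p) x * g x)) +
   tsin (freq p) y * (\int[mu]_(x in `[0, 1]) (tsin (freq p) x * g x)))).
  apply: bounded_measurableM; first exact: bounded_measurable_cst.
  apply: bounded_measurable_sum => p; apply: bounded_measurableD.
    apply: bounded_measurableM; last exact: bounded_measurable_cst.
    exact: bounded_measurable_tcos.
  apply: bounded_measurableM; last exact: bounded_measurable_cst.
  exact: bounded_measurable_tsin.
by apply/funext => y; rewrite fejer_meanE.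
Qed.

Lemma integrable_fejer_mean k g : mu.-integrable `[0, 1] (EFin \o g) ->
  mu.-integrable `[0, 1] (EFin \o fejer_mean k g).
Proof.
by move=> intg; apply/bounded_measurable_integrable01/bounded_measurable_fejer_mean.
Qed.

Lemma integrable_fejer_mul k g y : mu.-integrable `[0, 1] (EFin \o g) ->
  mu.-integrable `[0, 1] (EFin \o (fun x => fejer k (y - x) * g x)).
Proof.
move=> intg.
exact: (bounded_measurable_mul_integrable mI intg
  (bounded_measurable_fejer_sub k y)).
Qed.

Lemma fejer_meanB k f g y : mu.-integrable `[0, 1] (EFin \o f) ->
  mu.-integrable `[0, 1] (EFin \o g) ->
  fejer_mean k (fun x => f x - g x) y = fejer_mean k f y - fejer_mean k g y.
Proof.
move=> intf intg; rewrite /fejer_mean -RintegralB//; last 2 first.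
- exact: integrable_fejer_mul.
- exact: integrable_fejer_mul.
by apply: eq_Rintegral => x _; rewrite mulrBr.
Qed.

Lemma Rintegral_fejer_mean k u : (0 < k)%N ->
  mu.-integrable `[0, 1] (EFin \o u) ->
  \int[mu]_(y in `[0, 1]) fejer_mean k u y = \int[mu]_(x in `[0, 1]) u x.
Proof.
move=> k0 intu; under eq_Rintegral do rewrite fejer_meanE//.
have intp (p : 'I_k * 'I_k) : mu.-integrable `[0, 1] (EFin \o (fun y =>
    tcos (freq p) y * (\int[mu]_(x in `[0, 1]) (tcos (freq p) x * u x)) +
    tsin (freq p) y * (\int[mu]_(x in `[0, 1]) (tsin (freq p) x * u x)))).
  apply/bounded_measurable_integrable01/bounded_measurableD.
    apply: bounded_measurableM; last exact: bounded_measurable_cst.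
    exact: bounded_measurable_tcos.
  apply: bounded_measurableM; last exact: bounded_measurable_cst.
  exact: bounded_measurable_tsin.
rewrite RintegralZl//; last first.
  rewrite (_ : EFin \o _ = fun y => (\sum_(p : 'I_k * 'I_k)
    (tcos (freq p) y * (\int[mu]_(x in `[0, 1]) (tcos (freq p) x * u x)) +
    tsin (freq p) y * (\int[mu]_(x in `[0, 1]) (tsin (freq p) x * u x)))%:E)%E).
    by apply: integrable_sum => // p _; exact: intp.
  by apply/funext => y /=; rewrite sumEFin.
rewrite Rintegral_sum//.
rewrite (eq_bigr (fun p => (freq p == 0)%:R * \int[mu]_(x in `[0, 1]) u x)).
  by rewrite -mulr_suml sum_freq_eq0 mulKf// pnatr_eq0 -lt0n.
move=> p _.
have intc := bounded_measurable_integrable01 (bounded_measurable_tcos R (freq p)).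
have ints := bounded_measurable_integrable01 (bounded_measurable_tsin R (freq p)).
rewrite RintegralD//; last 2 first.
- apply/bounded_measurable_integrable01/bounded_measurableM.
    exact: bounded_measurable_tcos.
  exact: bounded_measurable_cst.
- apply/bounded_measurable_integrable01/bounded_measurableM.
    exact: bounded_measurable_tsin.
  exact: bounded_measurable_cst.
rewrite !RintegralZr// Rintegral01_tcos Rintegral01_tsin mul0r addr0.
case: eqP => [->|_]; last by rewrite !mul0r.
by congr (_ * _); apply: eq_Rintegral => x _; rewrite tcos0 mul1r.
Qed.

(** By positivity of the kernel, the absolute value of the mean of [u] is at most the mean of the
    absolute value, and taking means preserves the integral. *)
Lemma fejer_mean_contraction k u : (0 < k)%N ->
  mu.-integrable `[0, 1] (EFin \o u) ->
  \int[mu]_(y in `[0, 1]) `|fejer_mean k u y| <= \int[mu]_(x in `[0, 1]) `|u x|.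
Proof.
move=> k0 intu.
have intnu : mu.-integrable `[0, 1] (EFin \o (fun x => `|u x|)).
  exact: (integrable_norm intu).
rewrite -(Rintegral_fejer_mean k0 intnu); apply: le_Rintegral => //.
- exact: (integrable_norm (integrable_fejer_mean k intu)).
- exact: integrable_fejer_mean.
move=> y _; apply: (le_trans (le_normr_Rintegral _ _)) => //.
  exact: integrable_fejer_mul.
rewrite le_eqVlt; apply/orP; left; apply/eqP/eq_Rintegral => x _.
by rewrite normrM (ger0_norm (fejer_ge0 _ _)).
Qed.

(** The kernel has mass 1, so the error is the mean of f x - f y; positivity allows the majorant to
    be integrated in its place. *)
Lemma fejer_mean_korovkin k f y (e C : R) : (0 < k)%N ->
  mu.-integrable `[0, 1] (EFin \o f) ->
  (forall x, 0 <= x <= 1 -> `|f x - f y| <= e + C * (1 - tcos 1 (y - x))) ->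
  `|fejer_mean k f y - f y| <= e + C / k%:R.
Proof.
move=> k0 intf fe.
have bK := bounded_measurable_fejer_sub k y.
have bt := bounded_measurable_tcos_sub 1 y.
have intK := bounded_measurable_integrable01 bK.
have intKt := bounded_measurable_integrable01 (bounded_measurableM bK bt).
have intc := bounded_measurable_integrable01 (bounded_measurable_cst R (f y)).
have intKe := bounded_measurable_integrable01
  (bounded_measurableM (bounded_measurable_cst R (e + C)) bK).
have intKt' := bounded_measurable_integrable01
  (bounded_measurableM (bounded_measurable_cst R C) (bounded_measurableM bK bt)).
have fyE : \int[mu]_(x in `[0, 1]) (fejer k (y - x) * f y) = f y.
  by rewrite RintegralZr// Rintegral_fejer_sub// mul1r.
have -> : fejer_mean k f y - f y =
    \int[mu]_(x in `[0, 1]) (fejer k (y - x) * (f x - f y)).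
  rewrite -[X in _ - X]fyE.
  rewrite -RintegralB//; last 2 first.
  - exact: integrable_fejer_mul.
  - apply/bounded_measurable_integrable01/bounded_measurableM => //.
    exact: bounded_measurable_cst.
  by apply: eq_Rintegral => x _; rewrite mulrBr.
have intfy : mu.-integrable `[0, 1] (EFin \o (fun x => f x - f y)).
  exact: (integrableB mI intf intc).
apply: (le_trans (le_normr_Rintegral mI (integrable_fejer_mul k y intfy))).
(* The two moments of the kernel give (e + C) - C (1 - 1/k). *)
have -> : e + C / k%:R = \int[mu]_(x in `[0, 1])
    ((e + C) * fejer k (y - x) - C * (fejer k (y - x) * tcos 1 (y - x))).
  rewrite RintegralB//.
  rewrite (RintegralZl _ _ intK)// Rintegral_fejer_sub//.
  rewrite (RintegralZl _ _ intKt)// Rintegral_fejer_tcos1_sub//.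
  by ring.
apply: le_Rintegral => //.
- exact: (integrable_norm (integrable_fejer_mul k y intfy)).
- exact: (integrableB mI intKe intKt').
move=> x; rewrite /= in_itv/= => x01.
rewrite normrM (ger0_norm (fejer_ge0 _ _)).
apply: (le_trans (ler_wpM2l (fejer_ge0 _ _) (fe _ x01))).
by rewrite le_eqVlt; apply/orP; left; apply/eqP; ring.
Qed.

End fejer_convergence.

(** * Convergence of Fejer means in L1 *)

Section fejer_L1.
Context (R : realType).
Local Notation mu := (@lebesgue_measure R).
Implicit Types (x y : R) (k : nat) (f g : R -> R).

(** The distance t from [x] to [y] lies in [e, 1 - e]; replacing t by 1 - t beyond 1/2 leaves the
    cosine unchanged and leads back to the range where it decreases. *)
Lemma tcos1_le_cos (e x y : R) : 0 < e -> e <= y -> e <= 1 - y ->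
  0 <= x <= 1 -> e <= `|y - x| -> tcos 1 (y - x) <= cos (2 * pi * e).
Proof.
move=> e0 ey ey1 /andP[x0 x1]; set t := `|y - x| => et.
have t1e : t <= 1 - e by rewrite /t ler_norml; lra.
have pi0 := pi_gt0 R.
have -> : tcos 1 (y - x) = cos (2 * pi * t).
  rewrite /tcos mulr1 -cos_norm normrM ger0_norm//.
  by rewrite mulr_ge0// ltW.
have cos_le s : e <= s <= 1 / 2 -> cos (2 * pi * s) <= cos (2 * pi * e).
  move=> /andP[es s2]; rewrite leNgt ltr_cos ?in_itv/=.
  - by rewrite -leNgt ler_pM2l// mulr_gt0.
  - by nra.
  - by nra.
have [t2|t2] := leP t (1 / 2); first by apply: cos_le; lra.
have -> : cos (2 * pi * t) = cos (2 * pi * (1 - t)).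
  rewrite -[RHS]cosN -[in RHS](cosD2pi).
  by congr cos; rewrite -mulr_natl; ring.
by apply: cos_le; lra.
Qed.

(** Near [y] continuity gives [e]; away from [y] the difference is at most 2 B, while 1 - cos stays
    above a positive constant, and [C] is the quotient of the two. *)
Lemma continuous_korovkin_bound f y (B e : R) : 0 < y < 1 ->
  (forall x, 0 <= x <= 1 -> `|f x| <= B) -> {for y, continuous f} -> 0 < e ->
  exists C, forall x, 0 <= x <= 1 ->
    `|f x - f y| <= e + C * (1 - tcos 1 (y - x)).
Proof.
move=> /andP[y0 y1] fB cf e0.
have pi0 := pi_gt0 R.
have [eta eta0 feta] : exists2 eta, 0 < eta &
    forall x, `|y - x| < eta -> `|f x - f y| <= e.
  move/cvgrPdist_le : cf => /(_ e e0) /nbhs_ballP [eta /= eta0 H].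
  by exists eta => // x yx; rewrite distrC; exact: H.
(* Points at distance at least [eta] are at distance at least [d]; the bounds by y and 1 - y keep
   them away from [y] also modulo 1. *)
pose d := Num.min eta (Num.min y (1 - y)).
have d0 : 0 < d by rewrite !lt_min; lra.
have [dy dy1 deta] : [/\ d <= y, d <= 1 - y & d <= eta].
  by rewrite /d !ge_min !lexx !orbT.
have c1 : cos (2 * pi * d) < 1.
  rewrite -[ltRHS]cos0 ltr_cos ?in_itv/=.
  - by rewrite !mulr_gt0.
  - by nra.
  - by nra.
have B0 : 0 <= B by apply: le_trans (fB y _) => //; lra.
have C0 : 0 <= 2 * B / (1 - cos (2 * pi * d)).
  by rewrite divr_ge0 ?mulr_ge0// subr_ge0 ltW.
exists (2 * B / (1 - cos (2 * pi * d))) => x x01.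
have t1 : 0 <= 1 - tcos 1 (y - x) by rewrite subr_ge0 cos_le1.
have [yx|yx] := ltP `|y - x| eta.
  by rewrite (le_trans (feta _ yx))// lerDl mulr_ge0.
have tc : tcos 1 (y - x) <= cos (2 * pi * d).
  by apply: tcos1_le_cos => //; exact: le_trans yx.
apply: ler_wpDl; first exact: ltW.
apply: (@le_trans _ _ (2 * B)).
  rewrite (le_trans (ler_normB _ _))// mulr_natl mulr2n lerD// ?fB//; lra.
rewrite mulrAC ler_pdivlMr ?subr_gt0//.
by rewrite ler_wpM2l ?mulr_ge0// lerB.
Qed.

(** The bound e/2 + C/k has [C] independent of k. Orders start at 1 because [fejer 0] is the zero
    function. *)
Lemma fejer_mean_cvg f y (B : R) : 0 < y < 1 ->
  mu.-integrable `[0, 1] (EFin \o f) ->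
  (forall x, 0 <= x <= 1 -> `|f x| <= B) -> {for y, continuous f} ->
  fejer_mean k.+1 f y @[k --> \oo] --> f y.
Proof.
move=> y01 intf fB cf; apply/cvgrPdist_le => e e0.
have e20 : 0 < e / 2 by rewrite divr_gt0.
have [C fC] := continuous_korovkin_bound y01 fB cf e20.
near=> k; rewrite distrC.
apply: (le_trans (fejer_mean_korovkin _ intf fC)) => //.
rewrite [leRHS]splitr lerD2l.
rewrite ler_pdivrMr ?ltr0Sn// (le_trans (ler_norm C))// -ler_pdivrMl//.
rewrite (@le_trans _ _ k%:R) ?ler_nat//; near: k; exact: nbhs_infty_ger.
Unshelve. all: by end_near. Qed.

Lemma normr_fejer_mean_le k f y (B : R) : (0 < k)%N ->
  mu.-integrable `[0, 1] (EFin \o f) ->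
  (forall x, 0 <= x <= 1 -> `|f x| <= B) -> `|fejer_mean k f y| <= B.
Proof.
move=> k0 intf fB.
have mI : measurable (`[0%R, 1%R]%classic : set (measurableTypeR R)) by [].
have bK := bounded_measurable_fejer_sub k y.
have intK := bounded_measurable_integrable01 bK.
apply: (le_trans (le_normr_Rintegral mI (integrable_fejer_mul k y intf))).
have <- : \int[mu]_(x in `[0, 1]) (fejer k (y - x) * B) = B.
  by rewrite RintegralZr// Rintegral_fejer_sub// mul1r.
apply: le_Rintegral => //.
- exact: (integrable_norm (integrable_fejer_mul k y intf)).
- exact: (bounded_measurable_integrable01
    (bounded_measurableM bK (bounded_measurable_cst R B))).
move=> x; rewrite /= in_itv/= => x01.
by rewrite normrM (ger0_norm (fejer_ge0 _ _)) ler_wpM2l ?fejer_ge0 ?fB.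
Qed.

Lemma fejer_mean_cvg_L1_continuous f (e : R) : continuous f ->
  mu.-integrable `[0, 1] (EFin \o f) -> 0 < e ->
  \forall k \near \oo, \int[mu]_(y in `[0, 1]) `|fejer_mean k.+1 f y - f y| < e.
Proof.
move=> cf intf e0.
have mI : measurable (`[0%R, 1%R]%classic : set (measurableTypeR R)) by [].
have [c _ fc] : exists2 c, c \in `[0%R, 1%R]%R &
    forall t, t \in `[0%R, 1%R]%R -> `|f t| <= `|f c|.
  apply: (@EVT_max _ (fun x => `|f x|)) => //.
  apply: continuous_subspaceT => x.
  by apply: continuous_comp; [exact: cf|exact: norm_continuous].
pose B := `|f c|.
have fB x : 0 <= x <= 1 -> `|f x| <= B by move=> x01; apply: fc; rewrite in_itv.
have B0 : 0 <= B by exact: normr_ge0.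
have mf : measurable_fun (`[0%R, 1%R]%classic : set (measurableTypeR R)) f.
  by apply/measurable_EFinP; exact: (measurable_int mu intf).
have bK k := bounded_measurable_fejer_mean k intf.
have intK k := integrable_fejer_mean k intf.
have [_ cvg0 _] : [/\ mu.-integrable `[0, 1] (EFin \o f),
    [sequence (\int[mu]_(x in `[0%R, 1%R])
       `|(fejer_mean n.+1 f x)%:E - (f x)%:E|)%E]_n @ \oo --> 0%E
  & [sequence (\int[mu]_(x in `[0%R, 1%R]) (fejer_mean n.+1 f x)%:E)%E]_n @ \oo
      --> (\int[mu]_(x in `[0%R, 1%R]) (f x)%:E)%E].
  apply: (@dominated_convergence _ _ _ mu _ mI
    (fun n x => (fejer_mean n.+1 f x)%:E) (EFin \o f) (fun=> B%:E)).
  - move=> n; apply/measurable_EFinP; apply: measurable_funTS.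
    by have [] := bK n.+1.
  - exact/measurable_EFinP.
  (* The endpoints, where pointwise convergence may fail, form a null set. *)
  - exists ([set 0] `|` [set 1]); split.
    + exact: measurableU.
    + by apply: null_set_setU => //; exact: lebesgue_measure_set1.
    + move=> x /= nx; apply: contrapT => x01; apply: nx.
      rewrite in_itv/= => x01'; apply/cvg_EFin; first by apply: nearW.
      apply: (@fejer_mean_cvg _ _ B) => //; last exact: cf.
      have x0 : x != 0 by apply/eqP => x0; apply: x01; left.
      have x1 : x != 1 by apply/eqP => x1; apply: x01; right.
      lra.
  - exact: bounded_measurable_integrable01 (bounded_measurable_cst R B).
  - apply: aeW => x n; rewrite /= in_itv/= => x01.
    by rewrite lee_fin; exact: normr_fejer_mean_le.
have /fine_cvg/cvgrPdist_lt/(_ e e0) := cvg0; apply: filterS => k.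
rewrite sub0r normrN ger0_norm; last first.
  by apply: fine_ge0; exact: integral_ge0.
by apply: le_lt_trans.
Qed.

Lemma fejer_mean_cvg_L1 g (e : R) :
  mu.-integrable `[0, 1] (EFin \o g) -> 0 < e ->
  exists2 k, (0 < k)%N & \int[mu]_(y in `[0, 1]) `|g y - fejer_mean k g y| < e.
Proof.
move=> intg e0.
have mI : measurable (`[0%R, 1%R]%classic : set (measurableTypeR R)) by [].
have e30 : 0 < e / 3 by rewrite divr_gt0.
have Ioo : (mu (`[0%R, 1%R]%classic : set R) < +oo)%E.
  by rewrite lebesgue_measure_01 ltry.
have [g_ [cg_ intg_ cvg_g]] := approximation_continuous_integrable mI Ioo intg.
have [f cf [intf gf]] : exists2 f, continuous f &
    mu.-integrable `[0, 1] (EFin \o f) /\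
    \int[mu]_(x in `[0, 1]) `|g x - f x| < e / 3.
  have /fine_cvg/cvgrPdist_lt/(_ _ e30) [n _ /(_ n (leqnn n))] := cvg_g.
  rewrite sub0r normrN ger0_norm; last first.
    by apply: fine_ge0; exact: integral_ge0.
  by move=> gn; exists (g_ n) => //; split.
have [n _ /(_ n (leqnn n)) Kf] := fejer_mean_cvg_L1_continuous cf intf e30.
exists n.+1 => //.
have intgf := integrableB mI intg intf.
have intKf := integrable_fejer_mean n.+1 intf.
have intKg := integrable_fejer_mean n.+1 intg.
have intKgf := integrable_fejer_mean n.+1 intgf.
have n1 := integrable_norm intgf.
have n2 := integrable_norm (integrableB mI intKf intf).
have n3 := integrable_norm intKgf.
have n0 := integrable_norm (integrableB mI intg intKg).
have := fejer_mean_contraction (ltn0Sn n) intgf => Kgf.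
(* The continuous [f] is inserted twice; the contraction bounds the third term by the first, so each
   of the three is below e/3. *)
apply: (@le_lt_trans _ _ (\int[mu]_(x in `[0, 1]) `|g x - f x| +
   \int[mu]_(x in `[0, 1]) `|fejer_mean n.+1 f x - f x| +
   \int[mu]_(x in `[0, 1]) `|fejer_mean n.+1 (fun x => g x - f x) x|)).
  rewrite -RintegralD// -RintegralD//; last exact: (integrableD mI n1 n2).
  apply: le_Rintegral => //.
    exact: (integrableD mI (integrableD mI n1 n2) n3).
  move=> x _; rewrite fejer_meanB//.
  set a := fejer_mean _ f _; set b := fejer_mean _ g _.
  have -> : g x - b = (g x - f x) - (a - f x) + (a - b) by ring.
  rewrite (le_trans (ler_normD _ _))// (distrC b) lerD2r//.
  exact: ler_normB.
lra.
Qed.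

End fejer_L1.

(** * Distance to uniformity and Fourier coefficients *)

Section smoothing_inequality.
Context d (T : measurableType d) (R : realType) (P : probability T R).
Local Notation mu := (@lebesgue_measure R).
Context (X Z : T -> R) (g : R -> R).
Context (mX : measurable_fun setT X) (mZ : measurable_fun setT Z).
Context (iXZ : independent2 P X Z) (Xg : has_density01 P X g).

Let mI : measurable (`[0%R, 1%R]%classic : set (measurableTypeR R)).
Proof. by []. Qed.

Let intg : mu.-integrable `[0, 1] (EFin \o g). Proof. by case: Xg. Qed.

Lemma measurable_add : measurable_fun setT (fun x : R * R => x.1 + x.2).
Proof. exact: measurable_funD. Qed.

Lemma fejer_mean_mod1 k x z : fejer_mean k g (mod1 (x + z) - z) = fejer_mean k g x.
Proof.
rewrite !fejer_meanE//; congr (_ * _); apply: eq_bigr => p _.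
have -> : mod1 (x + z) - z = x + (- Num.floor (x + z))%:~R.
  by rewrite /mod1 mulrNz; ring.
by rewrite tcosD tsinD tcosz tsinz !mulr1 !mulr0 subr0 addr0.
Qed.

(** The shift [z] is absorbed into the variable, as y - z - X = y - (X + z). The coefficients are
    thus those of [X + z], and averaging over z will turn them into those of the whole sum. *)
Lemma fejer_mean_expectation k y z : fejer_mean k g (y - z) =
  k%:R^-1 * \sum_(p : 'I_k * 'I_k)
   (tcos (freq p) y * \int[P]_t tcos (freq p) (X t + z) +
    tsin (freq p) y * \int[P]_t tsin (freq p) (X t + z)).
Proof.
have bshift n : bounded_measurable (fun t => tcos n (X t + z)) /\
    bounded_measurable (fun t => tsin n (X t + z)).
  have mXz : measurable_fun setT (fun t => X t + z) by exact: measurable_funD.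
  split; apply: (bounded_measurable_comp mXz).
    exact: bounded_measurable_tcos.
  exact: bounded_measurable_tsin.
have intc n := bounded_measurable_integrableP P (bshift n).1.
have ints n := bounded_measurable_integrableP P (bshift n).2.
rewrite /fejer_mean -(density_Rintegral mX Xg); last first.
  exact: bounded_measurable_fejer_sub.
have intcs (p : 'I_k * 'I_k) : P.-integrable setT (EFin \o (fun t =>
    tcos (freq p) y * tcos (freq p) (X t + z) +
    tsin (freq p) y * tsin (freq p) (X t + z))).
  apply/bounded_measurable_integrableP/bounded_measurableD.
    apply: bounded_measurableM; first exact: bounded_measurable_cst.
    by have [] := bshift (freq p).
  apply: bounded_measurableM; first exact: bounded_measurable_cst.
  by have [] := bshift (freq p).
under [in RHS]eq_bigr => p _.
  rewrite -RintegralZl// -RintegralZl// -RintegralD//; last 2 first.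
  - apply/bounded_measurable_integrableP/bounded_measurableM.
      exact: bounded_measurable_cst.
    by have [] := bshift (freq p).
  - apply/bounded_measurable_integrableP/bounded_measurableM.
      exact: bounded_measurable_cst.
    by have [] := bshift (freq p).
  over.
rewrite -Rintegral_sum// -RintegralZl//; last first.
  rewrite (_ : EFin \o _ = fun t => (\sum_(p : 'I_k * 'I_k)
    (tcos (freq p) y * tcos (freq p) (X t + z) +
    tsin (freq p) y * tsin (freq p) (X t + z))%:E)%E).
    by apply: integrable_sum => // p _; exact: intcs.
  by apply/funext => t /=; rewrite sumEFin.
apply: eq_Rintegral => t _; rewrite /fejer; congr (_ * _).
by apply: eq_bigr => p _; rewrite -addrA -opprD (addrC z) tcosB.
Qed.

Lemma smoothing_inequality (phi : R -> R) (k : nat) : (0 < k)%N ->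
  measurable_fun setT phi -> (forall x, `|phi x| <= 1) ->
  `|\int[P]_t phi (mod1 (X t + Z t)) - \int[mu]_(x in `[0, 1]) phi x| <=
  \int[mu]_(x in `[0, 1]) `|g x - fejer_mean k g x| +
  k%:R^-1 * \sum_(p : 'I_k * 'I_k | freq p != 0)
    (`|\int[P]_t tcos (freq p) (X t + Z t)| +
     `|\int[P]_t tsin (freq p) (X t + Z t)|).
Proof.
move=> k0 mphi phi1.
have bphi : bounded_measurable phi by split => //; exists 1.
have msh z : measurable_fun setT (fun x : R => mod1 (x + z)).
  by apply: (measurableT_comp (@measurable_mod1 R)); exact: measurable_funD.
have bphiz z := bounded_measurable_comp (msh z) bphi.
have badd (h : R -> R) : bounded_measurable h ->
    bounded_measurable (fun x : R * R => h (x.1 + x.2)).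
  exact: (bounded_measurable_comp measurable_add).
have bphim := bounded_measurable_comp (@measurable_mod1 R) bphi.
have [] := independent2_Fubini mX mZ iXZ (badd _ bphim).
rewrite /= => intPhi ->.
(* [a] and [b] are the real Fourier coefficients of [phi], bounded by 1; [c] and [s] are those of
   [X + z]. *)
pose a n := \int[mu]_(y in `[0, 1]) (phi y * tcos n y).
pose b n := \int[mu]_(y in `[0, 1]) (phi y * tsin n y).
pose c n z := \int[P]_t tcos n (X t + z).
pose s n z := \int[P]_t tsin n (X t + z).
have FubC n := independent2_Fubini mX mZ iXZ (badd _ (bounded_measurable_tcos R n)).
have FubS n := independent2_Fubini mX mZ iXZ (badd _ (bounded_measurable_tsin R n)).
have intC n : P.-integrable setT (EFin \o (fun t => c n (Z t))) by have [] := FubC n.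
have intS n : P.-integrable setT (EFin \o (fun t => s n (Z t))) by have [] := FubS n.
have PsiE z : \int[mu]_(x in `[0, 1]) (phi (mod1 (x + z)) * fejer_mean k g x) =
    k%:R^-1 * \sum_(p : 'I_k * 'I_k)
      (a (freq p) * c (freq p) z + b (freq p) * s (freq p) z).
  (* The Fejer mean is 1-periodic, so the translation by z can be moved to it. *)
  pose Psi y := phi y * fejer_mean k g (y - z).
  have bPsi : bounded_measurable Psi.
    apply: bounded_measurableM => //.
    have mz : measurable_fun setT (fun y : R => y - z) by exact: measurable_funB.
    exact: (bounded_measurable_comp mz (bounded_measurable_fejer_mean k intg)).
  transitivity (\int[mu]_(x in `[0, 1]) Psi (mod1 (x + z))).
    by apply: eq_Rintegral => x _; rewrite /Psi fejer_mean_mod1.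
  rewrite Rintegral_mod1// /Psi.
  have bpt (p : 'I_k * 'I_k) : bounded_measurable (fun y =>
      phi y * tcos (freq p) y * c (freq p) z +
      phi y * tsin (freq p) y * s (freq p) z).
    apply: bounded_measurableD; apply: bounded_measurableM;
      try exact: bounded_measurable_cst; apply: bounded_measurableM => //.
      exact: bounded_measurable_tcos.
    exact: bounded_measurable_tsin.
  have bpc n : bounded_measurable (fun y => phi y * tcos n y).
    by apply: bounded_measurableM => //; exact: bounded_measurable_tcos.
  have bps n : bounded_measurable (fun y => phi y * tsin n y).
    by apply: bounded_measurableM => //; exact: bounded_measurable_tsin.
  have intpc n := bounded_measurable_integrable01 (bpc n).
  have intps n := bounded_measurable_integrable01 (bps n).
  have intpt p := bounded_measurable_integrable01 (bpt p).
  under [in RHS]eq_bigr => p _.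
    rewrite /a /b -RintegralZr// -[X in _ + X]RintegralZr//.
    rewrite -RintegralD//; last 2 first.
    - apply/bounded_measurable_integrable01/bounded_measurableM => //.
      exact: bounded_measurable_cst.
    - apply/bounded_measurable_integrable01/bounded_measurableM => //.
      exact: bounded_measurable_cst.
    over.
  rewrite -Rintegral_sum// -RintegralZl//; last first.
    apply/bounded_measurable_integrable01.
    exact: (bounded_measurable_sum (index_enum _) bpt).
  apply: eq_Rintegral => y _; rewrite fejer_mean_expectation mulrCA.
  congr (_ * _); rewrite mulr_sumr; apply: eq_bigr => p _.
  by rewrite mulrDr !mulrA.
have PhiE z : \int[P]_t phi (mod1 (X t + z)) =
    \int[mu]_(x in `[0, 1]) (phi (mod1 (x + z)) * g x).
  exact: (density_Rintegral mX Xg).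
(* This estimate holds for each fixed [z] with a bound free of [z], so it survives averaging over
   [Z]. *)
have PhiPsi z : `|\int[P]_t phi (mod1 (X t + z)) - k%:R^-1 *
    \sum_(p : 'I_k * 'I_k)
      (a (freq p) * c (freq p) z + b (freq p) * s (freq p) z)| <=
    \int[mu]_(x in `[0, 1]) `|g x - fejer_mean k g x|.
  have intK := integrable_fejer_mean k intg.
  have intgK := integrableB mI intg intK.
  have i1 := bounded_measurable_mul_integrable mI intg (bphiz z).
  have i2 := bounded_measurable_mul_integrable mI intK (bphiz z).
  rewrite -PsiE PhiE -RintegralB//.
  apply: (le_trans (le_normr_Rintegral mI (integrableB mI i1 i2))).
  apply: le_Rintegral => //.
  - exact: (integrable_norm (integrableB mI i1 i2)).
  - exact: (integrable_norm intgK).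
  - by move=> x _; rewrite -mulrBr normrM ler_piMl.
have intaC n : P.-integrable setT (EFin \o (fun t => a n * c n (Z t))).
  exact: (integrableZl _ _ (intC n)).
have intbS n : P.-integrable setT (EFin \o (fun t => b n * s n (Z t))).
  exact: (integrableZl _ _ (intS n)).
have intp (p : 'I_k * 'I_k) : P.-integrable setT (EFin \o (fun t =>
    a (freq p) * c (freq p) (Z t) + b (freq p) * s (freq p) (Z t))).
  exact: (integrableD _ (intaC _) (intbS _)).
have intsum : P.-integrable setT (EFin \o (fun t => \sum_(p : 'I_k * 'I_k)
    (a (freq p) * c (freq p) (Z t) + b (freq p) * s (freq p) (Z t)))).
  rewrite (_ : EFin \o _ = fun t => (\sum_(p : 'I_k * 'I_k)
      (a (freq p) * c (freq p) (Z t) + b (freq p) * s (freq p) (Z t))%:E)%E).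
    by apply: integrable_sum => // p _; exact: intp.
  by apply/funext => t /=; rewrite sumEFin.
have intPsi : P.-integrable setT (EFin \o (fun t => k%:R^-1 * \sum_(p : 'I_k * 'I_k)
    (a (freq p) * c (freq p) (Z t) + b (freq p) * s (freq p) (Z t)))).
  exact: (integrableZl _ _ intsum).
have EPsi : \int[P]_t (k%:R^-1 * \sum_(p : 'I_k * 'I_k)
    (a (freq p) * c (freq p) (Z t) + b (freq p) * s (freq p) (Z t))) =
  k%:R^-1 * \sum_(p : 'I_k * 'I_k)
    (a (freq p) * \int[P]_t tcos (freq p) (X t + Z t) +
     b (freq p) * \int[P]_t tsin (freq p) (X t + Z t)).
  rewrite RintegralZl// Rintegral_sum//; congr (_ * _); apply: eq_bigr => p _.
  by rewrite RintegralD// !RintegralZl// (FubC _).2 (FubS _).2.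
have bound : `|k%:R^-1 * \sum_(p : 'I_k * 'I_k)
    (a (freq p) * \int[P]_t tcos (freq p) (X t + Z t) +
     b (freq p) * \int[P]_t tsin (freq p) (X t + Z t)) -
     \int[mu]_(x in `[0, 1]) phi x| <=
    k%:R^-1 * \sum_(p : 'I_k * 'I_k | freq p != 0)
    (`|\int[P]_t tcos (freq p) (X t + Z t)| +
     `|\int[P]_t tsin (freq p) (X t + Z t)|).
  have P1 : \int[P]_t (1 : R) = 1.
    rewrite Rintegral_cst// [X in fine X](_ : _ = 1%E) ?mulr1//.
    exact: probability_setT.
  have a1 n : `|a n| <= 1.
    apply: normr_Rintegral_le => //.
    - by have := lebesgue_measure_01 R => /= ->.
    - by apply/bounded_measurable_integrable01/bounded_measurableM => //;
        exact: bounded_measurable_tcos.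
    - by move=> x _; rewrite normrM mulr_ile1// normr_tcos_le1.
  have b1 n : `|b n| <= 1.
    apply: normr_Rintegral_le => //.
    - by have := lebesgue_measure_01 R => /= ->.
    - by apply/bounded_measurable_integrable01/bounded_measurableM => //;
        exact: bounded_measurable_tsin.
    - by move=> x _; rewrite normrM mulr_ile1// normr_tsin_le1.
  (* The k pairs of frequency 0 each contribute the mean of [phi]; after division by k they cancel
     the subtracted mean. *)
  rewrite (bigID (fun p : 'I_k * 'I_k => freq p == 0))/=.
  rewrite (eq_bigr (fun=> \int[mu]_(x in `[0, 1]) phi x)); last first.
    move=> p /eqP ->; under eq_Rintegral do rewrite tcos0.
    under [X in _ + _ * X]eq_Rintegral do rewrite tsin0.
    rewrite P1 Rintegral_cst// mul0r mulr0 mulr1 addr0 /a.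
    by apply: eq_Rintegral => x _; rewrite tcos0 mulr1.
  have kN0 : k%:R != 0 :> R by rewrite pnatr_eq0 -lt0n.
  rewrite (_ : \sum_(p | freq p == 0) _ = k%:R * \int[mu]_(x in `[0, 1]) phi x).
    rewrite mulrDr mulKf// addrAC subrr add0r normrM gtr0_norm ?invr_gt0 ?ltr0n//.
    rewrite ler_wpM2l ?invr_ge0// (le_trans (ler_norm_sum _ _ _))//.
    apply: ler_sum => p _; rewrite (le_trans (ler_normD _ _))//.
    by rewrite !normrM lerD// ler_piMl.
  rewrite -(sum_freq_eq0 R k) mulr_suml big_mkcond/=; apply: eq_bigr => p _.
  by case: eqP; rewrite ?mul1r ?mul0r.
(* The finite combination returns under the expectation over [Z], so that J - L is one integral to
   which [PhiPsi] applies pointwise. *)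
rewrite -EPsi in bound.
set I := \int[mu]_(x in _) _; set J := \int[P]_t _.
move: bound; rewrite -/I; set L := (X in `|X - I| <= _) => bound.
apply: (le_trans (y := `|J - L| + `|L - I|)).
  by rewrite (le_trans _ (ler_normD _ _))// addrA subrK.
apply: lerD => //; rewrite /J /L -RintegralB//.
apply: normr_Rintegral_le => //.
- exact: probability_le1.
- exact: Rintegral_ge0.
- exact: (integrableB measurableT intPhi intPsi).
Qed.

End smoothing_inequality.

Section complex_limits.
Context (R : realType).

Lemma normc_real (a : R) : `|a%:C| = `|a|%:C.
Proof. by rewrite normc_def /= expr0n /= addr0 sqrtr_sqr. Qed.

Lemma complex_cvg0P (u : nat -> R[i]) :
  (u : nat -> R[i]^o) @ \oo --> (0 : R[i]^o) <->
  (fun n => complex.Re (u n)) @ \oo --> (0 : R) /\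
  (fun n => complex.Im (u n)) @ \oo --> (0 : R).
Proof.
split.
  move/cvgrPdist_lt => u0; split; apply/cvgrPdist_lt => e e0;
    have e0' : 0 < e%:C by rewrite ltcR.
    apply: filterS (u0 _ e0') => n; rewrite !sub0r !normrN => une.
    by rewrite -ltcR; apply: le_lt_trans une; exact: normc_ge_Re.
  apply: filterS (u0 _ e0') => n; rewrite !sub0r !normrN => une.
  rewrite -ltcR; apply: le_lt_trans une; rewrite normc_def lecR.
  by rewrite -sqrtr_sqr ler_sqrt ?lerDr ?sqr_ge0// addr_ge0 ?sqr_ge0.
move=> [re0 im0]; apply/cvgrPdist_lt => -[e e'].
(* In the order of [R[i]], a positive epsilon has zero imaginary part. *)
rewrite ltcE /= => /andP[/eqP -> e0] {e'}.
have e20 : 0 < e / 2 by rewrite divr_gt0.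
move/cvgrPdist_lt : re0 => /(_ _ e20) re0.
move/cvgrPdist_lt : im0 => /(_ _ e20) im0.
near=> n; rewrite sub0r normrN.
have rn : `|complex.Re (u n)| < e / 2.
  by rewrite -normrN -sub0r; near: n; exact: re0.
have i_n : `|complex.Im (u n)| < e / 2.
  by rewrite -normrN -sub0r; near: n; exact: im0.
rewrite (_ : e +i* 0 = e%:C)//.
rewrite [u n]complexE.
apply: (le_lt_trans (ler_normD _ _)).
rewrite normrM.
have -> : `|'i%C| = 1 :> R[i].
  by rewrite normc_def /= expr0n /= add0r expr1n sqrtr1.
by rewrite mul1r !normc_real -rmorphD ltcR [ltRHS]splitr ltrD.
Unshelve. all: by end_near. Qed.

End complex_limits.

Section fourier.
Context d (T : measurableType d) (R : realType) (P : probability T R).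
Local Notation mu := (@lebesgue_measure R).

(** The expectation of e^(-2 i pi n X); the minus sign matches the convention of [fourier_coef]. *)
Definition char_fun (X : T -> R) (n : int) : R[i] :=
  \int[P]_t tcos n (X t) -i* \int[P]_t tsin n (X t).

Lemma fourier_coef_char_fun (X : T -> R) (g : R -> R) (n : int) :
  measurable_fun setT X -> has_density01 P X g ->
  fourier_coef g n = char_fun X n.
Proof.
move=> mX Xg.
have mI : measurable (`[0%R, 1%R]%classic : set (measurableTypeR R)) by [].
have intg : mu.-integrable `[0, 1] (EFin \o g) by case: Xg.
rewrite /fourier_coef /integral01C /char_fun.
rewrite (density_Rintegral mX Xg (bounded_measurable_tcos R n)).
rewrite (density_Rintegral mX Xg (bounded_measurable_tsin R n)).
congr (_ +i* _); first apply: eq_Rintegral => x _ /=.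
  by rewrite mul0r subr0 cosN mulrC.
rewrite -mulN1r -RintegralZl//; last first.
  exact: (bounded_measurable_mul_integrable mI intg (bounded_measurable_tsin R n)).
apply: eq_Rintegral => x _ /=.
by rewrite mul0r addr0 sinN mulN1r mulrN mulrC.
Qed.

Lemma independent2_RintegralM (X Z : T -> R) (f h : R -> R) :
  measurable_fun setT X -> measurable_fun setT Z -> independent2 P X Z ->
  bounded_measurable f -> bounded_measurable h ->
  \int[P]_t (f (X t) * h (Z t)) =
  (\int[P]_t f (X t)) * (\int[P]_t h (Z t)).
Proof.
move=> mX mZ iXZ bf bh.
have bfh : bounded_measurable (fun x : R * R => f x.1 * h x.2).
  apply: bounded_measurableM.
    exact: (bounded_measurable_comp measurable_fst bf).
  exact: (bounded_measurable_comp measurable_snd bh).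
have [_ ->] := independent2_Fubini mX mZ iXZ bfh.
have intf := bounded_measurable_integrableP P (bounded_measurable_comp mX bf).
have inth := bounded_measurable_integrableP P (bounded_measurable_comp mZ bh).
rewrite -RintegralZl//; apply: eq_Rintegral => t _ /=.
by rewrite RintegralZr.
Qed.

Lemma char_funD (X Z : T -> R) (n : int) :
  measurable_fun setT X -> measurable_fun setT Z -> independent2 P X Z ->
  char_fun (fun t => X t + Z t) n = char_fun X n * char_fun Z n.
Proof.
move=> mX mZ iXZ; rewrite /char_fun.
have bc := bounded_measurable_tcos R n.
have bs := bounded_measurable_tsin R n.
have int2 (f h : R -> R) : bounded_measurable f -> bounded_measurable h ->
    P.-integrable setT (EFin \o (fun t => f (X t) * h (Z t))).
  move=> bf bh; apply/bounded_measurable_integrableP/bounded_measurableM.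
    exact: (bounded_measurable_comp mX bf).
  exact: (bounded_measurable_comp mZ bh).
under eq_Rintegral do rewrite tcosD.
under [X in - X]eq_Rintegral do rewrite tsinD.
rewrite RintegralB//; [|exact: int2|exact: int2].
rewrite RintegralD//; [|exact: int2|exact: int2].
rewrite !independent2_RintegralM//.
by apply/eqP; rewrite eq_complex /=; apply/andP; split; apply/eqP; ring.
Qed.

Lemma prod_fourier_coef (Y : nat -> {RV P >-> R}) (g : nat -> R -> R)
    (s : seq nat) (n : int) : mutually_independent Y ->
  (forall m, has_density01 P (Y m) (g m)) -> uniq s ->
  \prod_(m <- s) fourier_coef (g m) n = char_fun (seq_sum Y s) n.
Proof.
move=> Yi Yg; elim: s => [_|m s IH us].
  rewrite big_nil /char_fun /seq_sum.
  under eq_Rintegral do rewrite big_nil /tcos mulr0 cos0.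
  under [X in - X]eq_Rintegral do rewrite big_nil /tsin mulr0 sin0.
  rewrite !Rintegral_cst// mul0r oppr0 [X in fine X](_ : _ = 1%E) ?mulr1//.
  exact: probability_setT.
rewrite big_cons IH; last by move: us => /= /andP[].
rewrite (fourier_coef_char_fun n _ (Yg m))// -char_funD//.
- by congr char_fun; apply/funext => t; rewrite /seq_sum big_cons.
- exact: measurable_seq_sum.
- exact: independent2_seq_sum.
Qed.

Lemma char_fun_mod1 (X : T -> R) (n : int) :
  char_fun (fun t => mod1 (X t)) n = char_fun X n.
Proof.
rewrite /char_fun; under eq_Rintegral do rewrite tcos_mod1.
by under [X in - X]eq_Rintegral do rewrite tsin_mod1.
Qed.

End fourier.

(** * Existence of a density for the sum and duality for the L1 distance *)

Section density_mod1.
Context d (T : measurableType d) (R : realType) (P : probability T R).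
Local Notation mu := (@lebesgue_measure R).

Lemma Rintegral_indic d' (T' : measurableType d') (m : {measure set T' -> \bar R})
    (D B : set T') : measurable D -> measurable B ->
  \int[m]_(x in D) (\1_B x : R) = fine (m (B `&` D)).
Proof. by move=> mD mB; rewrite /Rintegral integral_indic. Qed.

Lemma dominated_has_density01 (X : T -> R) : measurable_fun setT X ->
  (forall t, 0 <= X t < 1) ->
  (forall A : set R, measurable A -> mu A = 0%E -> P (X @^-1` A) = 0%E) ->
  exists h, has_density01 P X h.
Proof.
move=> mX X01 Xnull.
have mI : measurable (`[0%R, 1%R]%classic : set (measurableTypeR R)) by [].
have mX' : measurable_fun setT (X : T -> measurableTypeR R) by exact: mX.
pose nu := distribution P (mfun_of mX').
have numu : nu `<< mu.
  by apply/null_content_dominatesP => A mA A0; exact: Xnull.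
have [f [f0 ffin intf nuE]] := radon_nikodym_sigma_finite numu.
exists (fine \o f); split => //.
- rewrite (_ : EFin \o _ = f); last by apply/funext => x /=; rewrite fineK.
  exact: (integrableS measurableT).
- by move=> x _; apply: fine_ge0.
move=> A mA.
under eq_integral do rewrite /= fineK//.
rewrite -nuE; last exact: measurableI.
(* Since [X] takes its values in [0, 1[, intersecting [A] with [0, 1] does not change the event. *)
congr (P _); apply/seteqP; split => t /=; last by case.
move=> At; split => //; have := X01 t; rewrite in_itv/= => /andP[-> ?].
exact: ltW.
Qed.

(** A rotation by a fixed z pulls a null set back to a null set of [0, 1], to which [X] gives
    probability 0; averaging over [Z] shows that the law of the sum modulo 1 is absolutely
    continuous. *)
Lemma exists_density_mod1_add (X Z : T -> R) (g : R -> R) :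
  measurable_fun setT X -> measurable_fun setT Z -> independent2 P X Z ->
  has_density01 P X g ->
  exists h, has_density01 P (fun t => mod1 (X t + Z t)) h.
Proof.
move=> mX mZ iXZ Xg.
have mI : measurable (`[0%R, 1%R]%classic : set (measurableTypeR R)) by [].
have intg : mu.-integrable `[0, 1] (EFin \o g) by case: Xg.
have mXZ : measurable_fun setT (fun t => mod1 (X t + Z t)).
  by apply: (measurableT_comp (@measurable_mod1 R)); exact: measurable_funD.
apply: dominated_has_density01 => //; first by move=> t; exact: mod1_itv.
move=> A mA A0.
have msh z : measurable_fun setT (fun x : R => mod1 (x + z)).
  by apply: (measurableT_comp (@measurable_mod1 R)); exact: measurable_funD.
have bA : bounded_measurable (\1_A : R -> R) by exact: bounded_measurable_indic.
have cond0 z : \int[P]_t (\1_A (mod1 (X t + z)) : R) = 0.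
  pose B := (fun x : R => mod1 (x + z)) @^-1` A.
  have mB : measurable B by exact: measurable_preimage.
  have := Rintegral_mod1 z bA.
  rewrite -[X in X = _]/(\int[mu]_(x in `[0, 1]) (\1_B x : R)).
  have mXB : measurable (X @^-1` B) by exact: measurable_preimage.
  rewrite !Rintegral_indic//.
  rewrite [X in _ = fine X](_ : _ = 0%E); last first.
    apply/eqP; rewrite eq_le measure_ge0 andbT -[leRHS]A0.
    by rewrite le_measure ?inE//; exact: measurableI.
  move=> B0.
  have BI0 : mu (B `&` `[0%R, 1%R]) = 0%E.
    rewrite -[LHS]fineK ?B0// ge0_fin_numE//.
    apply: (@le_lt_trans _ _ (mu `[0%R, 1%R]%classic)).
      by rewrite le_measure ?inE//; exact: measurableI.
    by rewrite lebesgue_measure_01 ltry.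
  rewrite setIT -[X in fine X]/(P (X @^-1` B)).
  case: Xg => _ _ _ ->//.
  rewrite null_set_integral//; first exact: measurableI.
  by apply: (measurable_funS mI) (measurable_int mu intg).
have bF : bounded_measurable (fun x : R * R => \1_A (mod1 (x.1 + x.2)) : R).
  apply: (bounded_measurable_comp (X := fun x : R * R => mod1 (x.1 + x.2))) => //.
  by apply: (measurableT_comp (@measurable_mod1 R)); exact: measurable_funD.
have [_] := independent2_Fubini mX mZ iXZ bF.
under [RHS]eq_Rintegral do rewrite cond0.
rewrite Rintegral_cst// mul0r.
rewrite -[X in X = _]/(\int[P]_t (\1_((fun t => mod1 (X t + Z t)) @^-1` A) t : R)).
rewrite Rintegral_indic// ?setIT; last exact: measurable_preimage.
move=> P0; rewrite -[LHS]fineK ?P0// fin_num_measure//.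
exact: measurable_preimage.
Qed.

Lemma L1_distance_dual (S : T -> R) (h : R -> R) :
  measurable_fun setT S -> has_density01 P S h ->
  exists phi : R -> R, [/\ measurable_fun setT phi, forall x, `|phi x| <= 1 &
    \int[mu]_(x in `[0, 1]) `|h x - 1| =
    \int[P]_t phi (S t) - \int[mu]_(x in `[0, 1]) phi x].
Proof.
move=> mS Sh.
have mI : measurable (`[0%R, 1%R]%classic : set (measurableTypeR R)) by [].
have inth : mu.-integrable `[0, 1] (EFin \o h) by case: Sh.
have mh : measurable_fun (`[0%R, 1%R]%classic : set (measurableTypeR R)) h.
  by apply/measurable_EFinP; exact: (measurable_int mu inth).
(* [h] is only known to be measurable on [0, 1]; intersecting with it makes [phi], worth 1 on [A]
   and -1 elsewhere, measurable on the whole line. *)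
pose A := `[0%R, 1%R]%classic `&` h @^-1` `[1, +oo[%classic.
have mA : measurable (A : set R) by exact: mh.
pose phi x : R := 2 * \1_A x - 1.
have mphi : measurable_fun setT phi.
  by apply: measurable_funB => //; apply: measurable_funM => //;
    exact: measurable_indic.
have phi1 x : `|phi x| <= 1.
  rewrite /phi indicE; case: (_ \in _);
    rewrite ?mulr1 ?mulr0 ?sub0r ?normrN ?normr1//.
  by rewrite ger0_norm; lra.
have bphi : bounded_measurable phi by split => //; exists 1.
exists phi; split => //.
rewrite (density_Rintegral mS Sh bphi) -RintegralB//; last 2 first.
- exact: (bounded_measurable_mul_integrable mI inth bphi).
- exact: bounded_measurable_integrable01.
apply: eq_Rintegral => x; rewrite inE/= => x01.
rewrite -[X in _ = _ - X]mulr1 -mulrBr /phi indicE.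
have [xA|xA] := boolP (x \in A).
  move: xA; rewrite inE /A => -[_] /=; rewrite in_itv/= andbT => h1.
  by rewrite ger0_norm ?subr_ge0//; ring.
have h1 : h x < 1.
  rewrite ltNge; apply: contra xA => h1; rewrite inE; split => //=.
  by rewrite in_itv/= h1.
by rewrite ltr0_norm ?subr_lt0//= mulr0n; ring.
Qed.

End density_mod1.

(** * The two implications for a sequence of sums *)

Section convergence.
Context d (T : measurableType d) (R : realType) (P : probability T R).
Local Notation mu := (@lebesgue_measure R).

Lemma integral_cvg0_Rintegral (h : nat -> R -> R) :
  (forall M, mu.-integrable `[0, 1] (EFin \o h M)) ->
  ((fun M => \int[mu]_(x in `[0%R, 1%R]) `|h M x - 1|%:E)%E @ \oo --> 0%E) <->
  ((fun M => \int[mu]_(x in `[0, 1]) `|h M x - 1|) @ \oo --> (0 : R)).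
Proof.
move=> inth.
have mI : measurable (`[0%R, 1%R]%classic : set (measurableTypeR R)) by [].
have inth1 M := integrable_norm (integrableB mI (inth M)
  (bounded_measurable_integrable01 (bounded_measurable_cst R (1 : R)))).
split; first by move=> /fine_cvg.
move=> h0; apply/fine_cvgP; split => //.
by apply: nearW => M; exact: (integrable_fin_num mI (inth1 M)).
Qed.

(** A test function bounded by 1 and of mean 0 has the same integral against h and against h - 1, so
    its expectation is at most the L1 distance to 1. *)
Lemma L1_cvg_fourier (S : nat -> T -> R) (h : nat -> R -> R) (n : int) : n != 0 ->
  (forall M, measurable_fun setT (S M)) ->
  (forall M, has_density01 P (S M) (h M)) ->
  (fun M => \int[mu]_(x in `[0, 1]) `|h M x - 1|) @ \oo --> (0 : R) ->
  (fun M => char_fun P (S M) n : R[i]^o) @ \oo --> (0 : R[i]^o).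
Proof.
move=> n0 mS Sh h0.
have mI : measurable (`[0%R, 1%R]%classic : set (measurableTypeR R)) by [].
have inth M : mu.-integrable `[0, 1] (EFin \o h M) by case: (Sh M).
have bound (f : R -> R) M : bounded_measurable f -> (forall x, `|f x| <= 1) ->
    \int[mu]_(x in `[0, 1]) f x = 0 ->
    `|\int[P]_t f (S M t)| <= \int[mu]_(x in `[0, 1]) `|h M x - 1|.
  move=> bf f1 f0; rewrite (density_Rintegral (mS M) (Sh M) bf).
  have intf := bounded_measurable_integrable01 bf.
  have intfh := bounded_measurable_mul_integrable mI (inth M) bf.
  have int1 := integrableB mI (inth M)
    (bounded_measurable_integrable01 (bounded_measurable_cst R (1 : R))).
  rewrite -[X in `|X|]subr0 -[in X in _ - X]f0 -RintegralB//.
  apply: (le_trans (le_normr_Rintegral mI (integrableB mI intfh intf))).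
  apply: le_Rintegral => //.
  - exact: (integrable_norm (integrableB mI intfh intf)).
  - exact: (integrable_norm int1).
  - by move=> x _; rewrite -[X in _ - X]mulr1 -mulrBr normrM ler_piMl.
apply/complex_cvg0P; split; apply/norm_cvg0P.
  apply: (squeeze_cvgr _ (cvg_cst 0) h0); apply: nearW => M.
  rewrite normr_ge0 /=; apply: bound.
  - exact: bounded_measurable_tcos.
  - exact: normr_tcos_le1.
  - by rewrite Rintegral01_tcos (negbTE n0).
apply: (squeeze_cvgr _ (cvg_cst 0) h0); apply: nearW => M.
rewrite normr_ge0 /= normrN; apply: bound.
- exact: bounded_measurable_tsin.
- exact: normr_tsin_le1.
- exact: Rintegral01_tsin.
Qed.

Lemma fourier_L1_cvg (X : T -> R) (g : R -> R) (Z : nat -> T -> R)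
    (h : nat -> R -> R) :
  measurable_fun setT X -> has_density01 P X g ->
  (forall M, measurable_fun setT (Z M)) ->
  (forall M, independent2 P X (Z M)) ->
  (forall M, has_density01 P (fun t => mod1 (X t + Z M t)) (h M)) ->
  (forall n : int, n != 0 ->
    (fun M => char_fun P (fun t => X t + Z M t) n : R[i]^o) @ \oo -->
      (0 : R[i]^o)) ->
  (fun M => \int[mu]_(x in `[0, 1]) `|h M x - 1|) @ \oo --> (0 : R).
Proof.
move=> mX Xg mZ iXZ Sh char0.
have intg : mu.-integrable `[0, 1] (EFin \o g) by case: Xg.
apply/cvgrPdist_lt => e e0.
have e20 : 0 < e / 2 by rewrite divr_gt0.
(* [k] is fixed here once for all M; the remaining term [r M] is a finite sum of sequences tending
   to 0. *)
have [k k0 gk] := fejer_mean_cvg_L1 intg e20.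
pose r M : R := k%:R^-1 * \sum_(p : 'I_k * 'I_k | freq p != 0)
  (`|\int[P]_t tcos (freq p) (X t + Z M t)| +
   `|\int[P]_t tsin (freq p) (X t + Z M t)|).
have r0 : r @ \oo --> (0 : R).
  rewrite -[X in _ --> X](mulr0 k%:R^-1); apply: cvgM; first exact: cvg_cst.
  rewrite [X in _ --> X](_ : 0 =
      \sum_(p : 'I_k * 'I_k | freq p != 0) (0 : R)); last by rewrite big1.
  apply: cvg_big; first exact: add_continuous.
  move=> p p0.
  have /complex_cvg0P[re im] := char0 _ p0.
  move: re im => /(iffRL (norm_cvg0P _)) re /(iffRL (norm_cvg0P _)) im.
  rewrite -[X in _ --> X]addr0; apply: cvgD; first exact: re.
  (* The imaginary part of [char_fun] is the opposite of the sine integral. *)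
  by under eq_fun do rewrite -normrN; exact: im.
move/cvgrPdist_lt : r0 => /(_ _ e20); apply: filterS => M.
rewrite !sub0r !normrN => rM.
have mS : measurable_fun setT (fun t => mod1 (X t + Z M t)).
  by apply: (measurableT_comp (@measurable_mod1 R)); exact: measurable_funD.
have [phi [mphi phi1 ->]] := L1_distance_dual mS (Sh M).
apply: (le_lt_trans (smoothing_inequality mX (mZ M) (iXZ M) Xg k0 mphi phi1)).
rewrite [ltRHS]splitr ltrD// (le_lt_trans _ rM)//.
exact: ler_norm.
Qed.

End convergence.

(* The sequences are indexed from 0: Y m, g m stand for Y_{m+1}, g_{m+1}, and
   h M is the density of the sum of the first M + 1 variables modulo 1.
   The topology on R[i]^o is the usual one of the complex plane. *)
Theorem theorem1p1 (R : realType) (d : measure_display) (T : measurableType d)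
    (P : probability T R) (Y : nat -> {RV P >-> R}) (g : nat -> R -> R)
    (Y_indep : mutually_independent Y)
    (Y_density : forall m : nat, has_density01 P (Y m) (g m)) :
  (exists h : nat -> R -> R, forall M : nat,
     has_density01 P (fun t => mod1 (\sum_(m < M.+1) Y m t)) (h M)) /\
  (forall h : nat -> R -> R,
     (forall M : nat,
        has_density01 P (fun t => mod1 (\sum_(m < M.+1) Y m t)) (h M)) ->
     ((fun M : nat =>
         (\int[@lebesgue_measure R]_(x in `[0%R, 1%R])
            `|h M x - 1|%:E)%E) @ \oo --> 0%E
      <->
      forall n : int, n != 0 ->
        (fun M : nat => \prod_(m < M.+1) fourier_coef (g m) n : R[i]^o) @ \oo
          --> (0 : R[i]^o))).
Proof.
have mY m : measurable_fun setT (Y m) by [].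
(* The variables of indices 1 to M, so that [Y 0] plus [Z M] has M + 1 terms; [Z 0] is the constant
   0. *)
pose Z M := seq_sum Y (iota 1 M).
have mZ M : measurable_fun setT (Z M) by exact: measurable_seq_sum.
have iYZ M : independent2 P (Y 0%N) (Z M).
  by apply: (independent2_seq_sum Y_indep); exact: (iota_uniq 0 M.+1).
have sumE M t : \sum_(m < M.+1) Y m t = Y 0%N t + Z M t.
  by rewrite -(big_mkord xpredT (fun m => Y m t)) big_ltn// /index_iota subSS subn0.
have SE M : (fun t => mod1 (\sum_(m < M.+1) Y m t)) =
    (fun t => mod1 (Y 0%N t + Z M t)).
  by apply/funext => t; rewrite sumE.
have prodE n M : \prod_(m < M.+1) fourier_coef (g m) n =
    char_fun P (fun t => Y 0%N t + Z M t) n.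
  rewrite -(big_mkord xpredT (fun m => fourier_coef (g m) n)) /index_iota subn0.
  rewrite (prod_fourier_coef _ Y_indep Y_density (iota_uniq _ _)).
  by congr char_fun; apply/funext => t; rewrite /seq_sum big_cons.
split.
  have [h hS] := choice (fun M =>
    exists_density_mod1_add (mY 0%N) (mZ M) (iYZ M) (Y_density 0%N)).
  by exists h => M; rewrite SE.
move=> h hS.
have Sh M : has_density01 P (fun t => mod1 (Y 0%N t + Z M t)) (h M).
  by rewrite -SE.
have inth M : (@lebesgue_measure R).-integrable `[0, 1] (EFin \o h M).
  by case: (Sh M).
have mS M : measurable_fun setT (fun t => mod1 (Y 0%N t + Z M t)).
  by apply: (measurableT_comp (@measurable_mod1 R)); exact: measurable_funD.
rewrite (integral_cvg0_Rintegral inth); split.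
  (* The density [h M] belongs to the reduced sum; at an integer frequency, reduction modulo 1 does
     not change the coefficient. *)
  move=> h0 n n0; under eq_fun do rewrite prodE -char_fun_mod1.
  exact: (L1_cvg_fourier n0 mS Sh).
move=> char0; apply: (fourier_L1_cvg (mY 0%N) (Y_density 0%N) mZ iYZ Sh).
by move=> n /char0; under eq_fun do rewrite prodE.
Qed.
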